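(* Let $N\ge 2$ be an integer and $0\le\beta<N$. Let $\sigma=(\sigma_1,\dots,\sigma_n)$ be distributed according to the Gibbs measure $P_{n,\beta}$ and set $W_n=\sqrt{\frac{N-\beta}{n}}\sum_{i=1}^n\sigma_i\in\mathbb{R}^N$. Then $$\sup_{g:\,L(g)\le 1,\,M(g)\le 1}\big|\mathbb{E}g(W_n)-\mathbb{E}g(Z)\big|\le\frac{c_\beta}{\sqrt n},$$ where $c_\beta$ is a constant depending only on $\beta$ (for the fixed $N$), $Z$ is a standard Gaussian random vector in $\mathbb{R}^N$, and the supremum is over functions $g:\mathbb{R}^N\to\mathbb{R}$ with Lipschitz constant $L(g)\le1$ and $M(g)\le 1$, $M(g)$ being the supremum over $\mathbb{R}^N$ of the operator norm of the Hessian of $g$.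
   Context: Mean-field $O(N)$ model: $\Omega_n=(\mathbb{S}^{N-1})^n$ with product $P_n$ of the uniform probability measure on $\mathbb{S}^{N-1}$; the Gibbs measure $P_{n,\beta}$ has density proportional to $\exp\left(\frac{\beta}{2n}\sum_{i,j=1}^n\langle\sigma_i,\sigma_j\rangle\right)$ with respect to $P_n$. *)

(* Defs.v *)
From HB Require Import structures.
From mathcomp Require Import all_boot all_order all_algebra.
From mathcomp Require Import all_classical all_reals all_analysis.
Set Implicit Arguments. Unset Strict Implicit. Unset Printing Implicit Defensive.
Import Order.TTheory GRing.Theory Num.Theory.
Import numFieldNormedType.Exports.
Local Open Scope classical_set_scope.
Local Open Scope ring_scope.

Section MeanFieldON.
Context {R : realType}.

Definition dotp {N : nat} (x y : 'rV[R]_N) : R := \sum_(i < N) x ord0 i * y ord0 i.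
Definition enorm {N : nat} (x : 'rV[R]_N) : R := Num.sqrt (dotp x x).
Definition unit_vec {N : nat} (i : 'I_N) : 'rV[R]_N := delta_mx 0 i.

Definition borelRN (N : nat) : set (set 'rV[R]_N) :=
  g_sigma_preimage (fun (i : 'I_N) (x : 'rV[R]_N) => (x ord0 i : R)).

Definition rvec_measurable {d} {T : measurableType d} {N : nat}
  (X : T -> 'rV[R]_N) : Prop :=
  forall i : 'I_N, measurable_fun setT (fun w => X w ord0 i).

(** X is distributed according to the uniform probability measure on the
    sphere S^{N-1}: the law of X is a probability measure carried by the
    sphere and invariant under every orthogonal transformation (this
    determines the normalized surface measure uniquely). *)
Definition uniform_sphere_rv {d} {T : measurableType d} (P : probability T R)
  {N : nat} (X : T -> 'rV[R]_N) : Prop :=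
  [/\ rvec_measurable X,
      P [set w | enorm (X w) = 1] = 1%E &
      forall O : 'M[R]_N, O *m O^T = 1%:M ->
        forall A, borelRN A ->
          P (X @^-1` A) = P ((fun w => X w *m O) @^-1` A)].

Definition mutually_independent {d} {T : measurableType d} (P : probability T R)
  {N n : nat} (X : 'I_n -> T -> 'rV[R]_N) : Prop :=
  forall A : 'I_n -> set 'rV[R]_N, (forall i, borelRN (A i)) ->
    P (\bigcap_(i in [set: 'I_n]) (X i @^-1` A i)) =
    (\prod_(i < n) P (X i @^-1` A i))%E.

Definition std_gaussian_rv {d} {T : measurableType d} (Q : probability T R)
  {N : nat} (Z : T -> 'rV[R]_N) : Prop :=
  rvec_measurable Z /\
  forall A : 'I_N -> set R, (forall i, measurable (A i)) ->
    Q (\bigcap_(i in [set: 'I_N]) ((fun w => Z w ord0 i) @^-1` A i)) =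
    (\prod_(i < N) normal_prob 0 1 (A i))%E.

Definition expect {d} {T : measurableType d} (P : probability T R)
  (f : T -> R) : R := fine (\int[P]_w (f w)%:E).

Definition gibbs_weight {N n : nat} (beta : R) (s : 'I_n -> 'rV[R]_N) : R :=
  expR (beta / (2 * n%:R) * \sum_(i < n) \sum_(j < n) dotp (s i) (s j)).

(** Expectation of F(sigma) when sigma ~ P_{n,beta}, where (X_i)_i has law P_n:
    P_{n,beta} has density proportional to gibbs_weight w.r.t. P_n. *)
Definition gibbs_expect {d} {T : measurableType d} (P : probability T R)
  {N n : nat} (beta : R) (X : 'I_n -> T -> 'rV[R]_N)
  (F : ('I_n -> 'rV[R]_N) -> R) : R :=
  expect P (fun w => F (fun i => X i w) * gibbs_weight beta (fun i => X i w))
  / expect P (fun w => gibbs_weight beta (fun i => X i w)).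

Definition Wn {N n : nat} (beta : R) (s : 'I_n -> 'rV[R]_N) : 'rV[R]_N :=
  Num.sqrt ((N%:R - beta) / n%:R) *: \sum_(i < n) s i.

Definition lipschitz_le1 {N : nat} (g : 'rV[R]_N -> R) : Prop :=
  forall x y, `|g x - g y| <= enorm (x - y).

Definition twice_differentiable {N : nat} (g : 'rV[R]_N -> R) : Prop :=
  (forall x, differentiable g x) /\
  (forall (i : 'I_N) x, differentiable ('D_(unit_vec i) g) x).

Definition hessian {N : nat} (g : 'rV[R]_N -> R) (x : 'rV[R]_N) : 'M[R]_N :=
  \matrix_(i < N, j < N) 'D_(unit_vec j) ('D_(unit_vec i) g) x.

Definition hessian_opnorm_le1 {N : nat} (g : 'rV[R]_N -> R) : Prop :=
  forall x (u : 'rV[R]_N), enorm (u *m hessian g x) <= enorm u.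

End MeanFieldON.

(* Main.v *)
Require Import Defs.
From HB Require Import structures.
From mathcomp Require Import all_boot all_order all_algebra.
From mathcomp Require Import all_classical all_reals all_analysis.
From mathcomp Require Import measurable_realfun.
From mathcomp Require Import ring lra.
Import Order.TTheory GRing.Theory Num.Theory.
Import numFieldNormedType.Exports.
Local Open Scope classical_set_scope.
Local Open Scope ring_scope.
Set Implicit Arguments. Unset Strict Implicit. Unset Printing Implicit Defensive.

(** Write [S_k] for the partial sums of the spins, put
    [h x = (g (sqrt ((N - beta) / n) x) - E g(Z)) exp (beta |x|^2 / (2 n))] and
    [U_m x = E h (x + sqrt (m / N) Z)]. By Gaussian scaling [U_n 0 = 0], and the partition function
    is at least 1, so the error is at most [|E h(S_n) - U_n 0|], which is telescoped over
    [E U_(n-k) (S_k)] as in Lindeberg's method.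

    Replacing one Gaussian step by one spin costs, by the Cameron-Martin formula,
    [E (h (x + sqrt (m / N) Z) - h x) q(Z)], where [q] compares the moment generating function [M] of
    the sphere with a Gaussian density. From [1 + |t|^2 / (2 N) <= M t <= exp (|t|^2 / (2 N))] one
    gets [q = O(m^-2)] up to factors that are integrable against the Gaussian weight, while, [g] being
    Lipschitz, the increment of [h] is [O(sqrt (m / n))]; thus the step costs
    [O(m^(-3/2) n^(-1/2))], which is summable in [m]. The quadratic exponential weights are
    controlled by [E exp (a |S_j|^2 / 2) <= exp (j a / (2 (1 - a j / N)))], proved by induction on
    [j]; this is where [beta < N] is needed. *)

(** * Random vectors and independence *)

(** The constant has to be uniform in [n], [g] and the probability spaces, while the increments of
    [h] are controlled to first order only. All smoothing therefore comes from the Gaussian steps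
    still to be taken: a shift of [x] by a spin becomes a change of density, which is averaged over
    the spin. Both sides of a swap being probability measures, [h x] can be subtracted; this
    supplies the factor sqrt (m / n), without which the sum would not decay in [n]. The final spin
    (m = 0) has no Gaussian left to smooth it, so its cost O(n^(-1/2)) is read off from the
    increment alone.

    The weight exp (beta |x|^2 / (2 n)) couples past and future. With k spins placed and l = n - k
    steps remaining, |x + y|^2 / n <= |x|^2 / k + |y|^2 / l separates it into a factor for the
    spins, whose moment is bounded uniformly in k, and a Gaussian factor whose exponent stays below
    the integrability threshold. An exponent b halfway between beta and N pays for the polynomial
    factors that arise on the way. *)

(* The Borel sigma-algebra [borelRN] as a [measurableType] structure. *)
Definition coord_system (R : realType) (N : nat) : set (set 'rV[R]_N) :=
  \big[setU/set0]_(i < N)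
    preimage_set_system setT (fun x : 'rV[R]_N => (x ord0 i : R)) measurable.
Notation rvec R N := (g_sigma_algebraType (@coord_system R N)).

Section measurability.
Context {R : realType} {N : nat}.
Implicit Types (d : measure_display).

Lemma measurable_coord (i : 'I_N) :
  measurable_fun setT (fun x : rvec R N => (x : 'rV[R]_N) ord0 i).
Proof.
move=> _ A mA; rewrite setTI; apply: sub_sigma_algebra.
rewrite /coord_system (bigD1 i)//=; left.
by exists A => //; rewrite setTI.
Qed.

Lemma measurable_rvec d (T : measurableType d) (X : T -> rvec R N) :
  rvec_measurable X <-> measurable_fun setT X.
Proof.
split=> [mX|mX i]; last exact: (measurableT_comp (measurable_coord i) mX).
apply: (@measurability _ _ T (rvec R N) setT X (@coord_system R N) erefl).
move=> _ [B + <-]; rewrite /coord_system => B_.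
rewrite setTI; suff : exists i : 'I_N, exists2 A, measurable A & (fun x : 'rV[R]_N => (x ord0 i : R)) @^-1` A = B.
  by move=> [i [A mA <-]]; have := mX i measurableT A mA; rewrite setTI.
elim/big_rec : _ B_ => //= i S _ IH [|]; last exact: IH.
by move=> [A mA <-]; exists i, A => //; rewrite setTI.
Qed.

Section closure.
Context d (T : measurableType d).
Implicit Types X Y : T -> rvec R N.

Lemma measurable_rvecD X Y : measurable_fun setT X -> measurable_fun setT Y ->
  measurable_fun setT (fun w => (X w + Y w)%R : rvec R N).
Proof.
move=> /measurable_rvec mX /measurable_rvec mY; apply/measurable_rvec => i.
rewrite (_ : (fun _ => _) = (fun w => X w ord0 i) \+ (fun w => Y w ord0 i)).
  exact: measurable_funD.
by apply/funext => w; rewrite mxE.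
Qed.

Lemma measurable_rvecZ (c : R) X : measurable_fun setT X ->
  measurable_fun setT (fun w => (c *: (X w : 'rV[R]_N)) : rvec R N).
Proof.
move=> /measurable_rvec mX; apply/measurable_rvec => i.
rewrite (_ : (fun _ => _) = (fun w => c * X w ord0 i)).
  exact: measurable_funM.
by apply/funext => w; rewrite mxE.
Qed.

Lemma measurable_rvec_sum I (s : seq I) (p : pred I) (X : I -> T -> rvec R N) :
  (forall i, measurable_fun setT (X i)) ->
  measurable_fun setT (fun w => (\sum_(i <- s | p i) (X i w : 'rV[R]_N)) : rvec R N).
Proof.
move=> mX; elim: s => [|i s IH].
  by under eq_fun do rewrite big_nil; exact: measurable_cst.
under eq_fun do rewrite big_cons.
by case: (p i) => //; exact: measurable_rvecD.
Qed.

Lemma measurable_dotp X Y : measurable_fun setT X -> measurable_fun setT Y ->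
  measurable_fun setT (fun w => dotp (X w) (Y w)).
Proof.
move=> /measurable_rvec mX /measurable_rvec mY.
by apply: measurable_sum => i; exact: measurable_funM.
Qed.

Lemma measurable_enorm X : measurable_fun setT X ->
  measurable_fun setT (fun w => enorm (X w)).
Proof.
move=> mX; apply: (measurableT_comp (continuous_measurable_fun (@sqrt_continuous R))).
exact: measurable_dotp.
Qed.

Lemma measurable_rvecM (O : 'M[R]_N) X : measurable_fun setT X ->
  measurable_fun setT (fun w => ((X w : 'rV[R]_N) *m O) : rvec R N).
Proof.
move=> /measurable_rvec mX; apply/measurable_rvec => i.
under eq_fun do rewrite mxE.
by apply: measurable_sum => k; exact: measurable_funM.
Qed.

End closure.
End measurability.

Section independence.
Context {R : realType} d (T : measurableType d) (P : probability T R).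
Context {N n : nat} (Y : 'I_n -> T -> rvec R N).
Hypothesis mY : forall i, measurable_fun setT (Y i).
Hypothesis indY : mutually_independent P Y.

Definition psum (j : nat) (w : T) : rvec R N :=
  \sum_(i < n | (i < j)%N) (Y i w : 'rV[R]_N).

Lemma measurable_psum j : measurable_fun setT (psum j).
Proof. exact: measurable_rvec_sum. Qed.

Lemma psum0 w : psum 0 w = 0.
Proof. by rewrite /psum big_pred0. Qed.

Lemma psumS (j : 'I_n) w : psum j.+1 w = psum j w + Y j w :> 'rV[R]_N.
Proof.
rewrite /psum (bigD1 j)//= addrC; congr (_ + _).
by apply: eq_bigl => i; rewrite ltnS ltn_neqAle andbC.
Qed.

Lemma psum_all w : psum n w = \sum_(i < n) (Y i w : 'rV[R]_N).
Proof. by apply: eq_bigl => i; rewrite ltn_ord. Qed.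

Let cyl (A : 'I_n -> set (rvec R N)) := \bigcap_(i in [set: 'I_n]) (Y i @^-1` A i).

Let mcyl A : (forall i, measurable (A i)) -> measurable (cyl A).
Proof.
move=> mA; apply: fin_bigcap_measurable => // i _.
by rewrite -[X in measurable X]setTI; exact: mY.
Qed.

Let preim_m d' (U : measurableType d') (f : T -> U) A :
  measurable_fun setT f -> measurable A -> measurable (f @^-1` A).
Proof. by move=> mf mA; rewrite -[X in measurable X]setTI; exact: mf. Qed.


Let pairY (j : 'I_n) w : rvec R N * rvec R N := (psum j w, Y j w).

Let pairY_m (j : 'I_n) : measurable_fun setT (pairY j).
Proof. by apply/measurable_fun_pairP; split; [exact: measurable_psum|exact: mY]. Qed.

Let law (U : T -> rvec R N) (mU : measurable_fun setT U) :
  probability (rvec R N) R := distribution P (mfun_Sub (mem_set mU)).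

(** On the event [cyl A], renormalised by its probability, the pair has a law that agrees with the
    product on rectangles, so uniqueness of the product measure extends the identity to all [X].
    Since [A] is trivial up to [j], a constraint on [Y j] can be inserted into the cylinder and the
    hypothesis on [psum j] applied. A null cylinder is treated apart because it cannot be
    renormalised. *)
Let indep_step (j : 'I_n) :
  (forall A B, (forall i, measurable (A i)) -> measurable B ->
     (forall i : 'I_n, (i < j)%N -> A i = setT) ->
     (P (psum j @^-1` B `&` cyl A) = P (psum j @^-1` B) * P (cyl A))%E) ->
  forall X A, measurable X -> (forall i, measurable (A i)) ->
     (forall i : 'I_n, (i <= j)%N -> A i = setT) ->
     (P (pairY j @^-1` X `&` cyl A) =
      (law (measurable_psum j) \x law (mY j)) X * P (cyl A))%E.
Proof.
move=> IH X A mX mA AT.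
have [c0|c0] := eqVneq (P (cyl A)) 0%E.
  rewrite c0 mule0; apply/eqP; rewrite eq_le measure_ge0 andbT -c0.
  apply: le_measure; last exact: subIsetr.
    by rewrite inE; exact: (measurableI _ _ (preim_m (pairY_m j) mX) (mcyl mA)).
  by rewrite inE; exact: mcyl.
have cfin : P (cyl A) \is a fin_num by apply: fin_num_measure; exact: mcyl.
pose r := fine (P (cyl A)).
have r0 : 0 < r by rewrite fine_gt0// lt0e c0 measure_ge0/= ltey_eq cfin.
have rE : P (cyl A) = r%:E by rewrite fineK.
have r'0 : 0 <= r^-1 by rewrite invr_ge0 ltW.
pose m1 : {measure set _ -> \bar R} := pushforward (mrestr P (mcyl mA)) (pairY j).
pose m' : {measure set _ -> \bar R} := mscale (NngNum r'0) (m1 (pairY_m j)).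
have := @product_measure_unique _ _ _ _ R (law (measurable_psum j)) (law (mY j)) m'.
move=> -> //; last first.
  move=> B C mB mC.
  rewrite [LHS](_ : _ = ((r^-1)%:E * P (pairY j @^-1` (B `*` C) `&` cyl A))%E)//.
  pose A' i := if i == j then C else A i.
  have mA' i : measurable (A' i) by rewrite /A'; case: ifP.
  have -> : pairY j @^-1` (B `*` C) `&` cyl A = psum j @^-1` B `&` cyl A'.
    apply/seteqP; split => [w [[/= Bw Cw] Aw]|w [/= Bw Aw]].
      split => // i _; rewrite /A'; case: eqVneq => [->|_] //.
      exact: Aw.
    split; first by split => //=; have := Aw j Logic.I; rewrite /A' eqxx.
    move=> i _; have := Aw i Logic.I; rewrite /A'; case: eqVneq => // -> _.
    by rewrite AT.
  rewrite IH//; last first.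
    by move=> i ij; rewrite /A' -val_eqE ltn_eqF//= AT// ltnW.
  have -> : P (cyl A') = (P (Y j @^-1` C) * r%:E)%E.
    rewrite -rE /cyl !indY// (bigD1 j)//= [in RHS](bigD1 j)//=.
    rewrite {1}/A' eqxx AT// preimage_setT probability_setT mul1e.
    congr (_ * _)%E; apply: eq_bigr => i ij.
    by rewrite /A' (negPf ij).
  rewrite muleCA; congr (_ * _)%E.
  by rewrite muleCA -EFinM mulVf ?mule1// gt_eqF.
rewrite [m' X](_ : _ = ((r^-1)%:E * P (pairY j @^-1` X `&` cyl A))%E)//.
rewrite rE muleAC -EFinM mulVf ?mul1e//.
by rewrite gt_eqF.
Qed.

(** Independence of a partial sum from all later vectors. In the induction, [psum j.+1] is addition
    applied to the pair of [psum j] and [Y j], so [B] is pulled back along addition and [indep_step]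
    applies. *)
Let indep_psum (j : nat) A B : (j <= n)%N ->
  (forall i, measurable (A i)) -> measurable B ->
  (forall i : 'I_n, (i < j)%N -> A i = setT) ->
  (P (psum j @^-1` B `&` cyl A) = P (psum j @^-1` B) * P (cyl A))%E.
Proof.
elim: j A B => [|j IH] A B jn mA mB AT.
  have -> : psum 0 @^-1` B = if 0 \in B then setT else set0.
    by apply/seteqP; split => w /=; rewrite psum0; case: ifPn; rewrite (inE, notin_setE).
  by case: ifP => _; rewrite ?setTI ?set0I ?probability_setT ?measure0 ?mul1e ?mul0e.
pose X := [set p : rvec R N * rvec R N | B (p.1 + p.2)].
have mX : measurable X.
  rewrite -[X]setTI.
  exact: (measurable_rvecD measurable_fst measurable_snd measurableT mB).
pose jo := Ordinal jn.
have XE : psum j.+1 @^-1` B = pairY jo @^-1` X.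
  by apply/seteqP; split => w /=; rewrite (psumS jo).
have st A' := @indep_step jo (fun A B => IH A B (ltnW jn)) X A' mX.
(* The trivial cylinder identifies the product measure of [X] with the probability of the
   pulled-back event. *)
have := st (fun=> setT) (fun=> measurableT) (fun _ _ => erefl).
have cT : cyl (fun=> setT) = setT by apply/seteqP; split.
rewrite cT setIT probability_setT mule1 XE => ->.
exact: (st A).
Qed.

Lemma psum_joint_law (j : 'I_n) X : measurable X ->
  P ((fun w => (psum j w, Y j w)) @^-1` X) =
  (law (measurable_psum j) \x law (mY j))%E X.
Proof.
move=> mX.
have cT : cyl (fun=> setT) = setT by apply/seteqP; split.
have := @indep_step j (fun A B => @indep_psum j A B (ltnW (ltn_ord j))) X
  (fun=> setT) mX (fun=> measurableT) (fun _ _ => erefl).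
by rewrite cT setIT probability_setT mule1.
Qed.

(** The independent copy of the next vector is realised by a second integration variable on the same
    probability space. *)
Lemma ge0_integral_psum (j : 'I_n) (f : rvec R N * rvec R N -> \bar R) :
  measurable_fun setT f -> (forall p, 0 <= f p)%E ->
  (\int[P]_w f (psum j w, Y j w) =
   \int[P]_w \int[P]_w' f (psum j w, Y j w'))%E.
Proof.
move=> mf f0.
pose pY := mfun_Sub (mem_set (pairY_m j)) : {mfun T >-> _}.
transitivity (\int[distribution P pY]_p f p)%E.
  by rewrite ge0_integral_distribution.
rewrite (@eq_measure_integral _ _ _ _
  (law (measurable_psum j) \x law (mY j))%E); last first.
  by move=> A mA _; rewrite /= -psum_joint_law.
rewrite fubini_tonelli1// ge0_integral_distribution//; last 2 first.
- exact: measurable_fun_fubini_tonelli_F.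
- by move=> x; apply: integral_ge0.
apply: eq_integral => w _ /=.
rewrite /fubini_F ge0_integral_distribution//.
exact: measurableT_comp mf (pair1_measurable _).
Qed.

End independence.

(** * Gaussian vectors under affine maps *)

Section normal_affine.
Context {R : realType}.
Notation mu := (@lebesgue_measure R).

Lemma ge0_integral_affine (a v : R) (f : R -> \bar R) : 0 < a ->
  measurable_fun setT f -> (forall x, 0 <= f x)%E ->
  (\int[mu]_x f (a * x + v)%R = (a^-1)%:E * \int[mu]_x f x)%E.
Proof.
move=> a0 mf f0.
pose aff (x : measurableTypeR R) : measurableTypeR R := a * x + v.
have maff : measurable_fun setT aff.
  by apply: measurable_funD => //; exact: measurable_funM.
pose m1 : {measure set _ -> \bar R} := pushforward mu aff.
have a0' : 0 <= a by exact: ltW.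
pose m2 : {measure set _ -> \bar R} := mscale (NngNum a0') (m1 maff).
have m2E A : measurable A -> mu A = m2 A.
  apply: lebesgue_measure_unique => //= _ [[b c]] _ <-.
  rewrite [RHS](_ : _ = (a%:E * mu (aff @^-1` `]b, c]%classic))%E)//.
  have -> : aff @^-1` `]b, c]%classic = `](b - v) / a, (c - v) / a]%classic.
    apply/seteqP; split => x /=; rewrite !in_itv/= /aff.
      by rewrite ltr_pdivrMr// ler_pdivlMr// ltrBlDr lerBrDr (mulrC x).
    by rewrite ltr_pdivrMr// ler_pdivlMr// ltrBlDr lerBrDr (mulrC x).
  rewrite !lebesgue_measure_itv/= !lte_fin ltr_pM2r ?invr_gt0// ltrD2r.
  case: ifP => _; last by rewrite mule0.
  rewrite -!EFinB -EFinM; congr (_%:E); field; exact: lt0r_neq0.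
rewrite [X in (_ * X)%E](@eq_measure_integral _ _ _ setT m2 mu); last first.
  by move=> A mA _; exact: m2E.
rewrite ge0_integral_mscale// muleA -EFinM mulVf ?gt_eqF// mul1e.
by rewrite ge0_integral_pushforward.
Qed.

Lemma ge0_integral_normal_prob (m s : R) (f : R -> \bar R) :
  measurable_fun setT f -> (forall x, 0 <= f x)%E ->
  (\int[normal_prob m s]_x f x = \int[mu]_x (f x * (normal_pdf m s x)%:E))%E.
Proof.
move=> mf f0; have dom := normal_prob_dominates m s.
rewrite -(Radon_Nikodym_SigmaFinite.change_of_variables dom)//=.
have ih := Radon_Nikodym_SigmaFinite.f_integrable dom.
apply: ae_eq_integral => //.
- by apply: emeasurable_funM => //; exact: (measurable_int mu ih).
- apply: emeasurable_funM => //; apply/measurable_EFinP.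
  exact: measurable_normal_pdf.
- apply: ae_eqe_mul2l.
  apply: integral_ae_eq => //.
  + by apply/measurable_EFinP; exact: measurable_normal_pdf.
  + by move=> E _ mE; rewrite -(Radon_Nikodym_SigmaFinite.f_integral dom).
Qed.

(** The density of the normal law with mean [v] and variance a^2 relative to the standard normal
    law. *)
Definition shift_density (a v x : R) : R :=
  a^-1 * expR (x ^+ 2 / 2 - (x - v) ^+ 2 / (2 * a ^+ 2)).

Lemma measurable_shift_density (a v : R) : measurable_fun setT (shift_density a v).
Proof.
apply: measurable_funM => //; apply: measurableT_comp => //.
apply: measurable_funB; first by apply: measurable_funM => //; exact: measurable_funX.
by apply: measurable_funM => //; apply: measurable_funX; exact: measurable_funB.
Qed.

Lemma ge0_integral_normal_affine (a v : R) (f : R -> \bar R) : 0 < a ->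
  measurable_fun setT f -> (forall x, 0 <= f x)%E ->
  (\int[normal_prob 0 1]_x f (a * x + v)%R =
   \int[normal_prob 0 1]_x (f x * (shift_density a v x)%:E))%E.
Proof.
move=> a0 mf f0.
have maff : measurable_fun setT (fun x : R => a * x + v).
  by apply: measurable_funD => //; exact: measurable_funM.
rewrite [LHS]ge0_integral_normal_prob//; last exact: measurableT_comp mf maff.
rewrite [RHS]ge0_integral_normal_prob; last 2 first.
- apply: emeasurable_funM => //; apply/measurable_EFinP.
  exact: measurable_shift_density.
- by move=> x; rewrite mule_ge0// lee_fin mulr_ge0 ?expR_ge0 ?invr_ge0 ?ltW.
pose h y : \bar R := (f y * (normal_pdf 0 1 ((y - v) / a))%:E)%E.
transitivity (\int[mu]_x h (a * x + v)%R)%E.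
  apply: eq_integral => x _; rewrite /h; congr (_ * (normal_pdf _ _ _)%:E)%E.
  by field; exact: lt0r_neq0.
rewrite ge0_integral_affine//; last 2 first.
- apply: emeasurable_funM => //; apply/measurable_EFinP.
  apply: measurableT_comp; first exact: measurable_normal_pdf.
  by apply: measurable_funM => //; exact: measurable_funB.
- by move=> x; rewrite mule_ge0// lee_fin normal_pdf_ge0.
rewrite -ge0_integralZl//; last 3 first.
- apply: emeasurable_funM => //; apply/measurable_EFinP.
  apply: measurableT_comp; first exact: measurable_normal_pdf.
  by apply: measurable_funM => //; exact: measurable_funB.
- by move=> x _; rewrite mule_ge0// lee_fin normal_pdf_ge0.
- by rewrite lee_fin invr_ge0 ltW.
apply: eq_integral => x _; rewrite /h muleCA -muleA; congr (_ * _)%E.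
rewrite -!EFinM; congr (_%:E).
rewrite !normal_pdfE ?oner_neq0// /normal_fun /shift_density.
rewrite mulrCA [RHS]mulrCA -mulrA; congr (_ * (_ * _)); rewrite -expRD; congr expR.
by field; exact: lt0r_neq0.
Qed.

End normal_affine.

Section gaussian_vector.
Context {R : realType} d (T : measurableType d) (Q : probability T R).
Context {N : nat} (Z : T -> rvec R N).
Hypothesis gZ : std_gaussian_rv Q Z.

Lemma measurable_gauss : measurable_fun setT Z.
Proof. by apply/measurable_rvec; case: gZ. Qed.

Let mZ i : measurable_fun setT (fun w => (Z w : 'rV[R]_N) ord0 i).
Proof. by case: gZ => + _; exact. Qed.

Lemma gauss_marginal (i : 'I_N) (A : set R) : measurable A ->
  Q ((fun w => (Z w : 'rV[R]_N) ord0 i) @^-1` A) = normal_prob 0 1 A.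
Proof.
move=> mA; case: gZ => _ /(_ (fun k => if k == i then A else setT)).
rewrite (bigD1 i)//= eqxx big1 ?mule1; last first.
  by move=> k /negPf ->; rewrite (@probability_setT _ _ _ (normal_prob 0 1)).
move=> <-; last by move=> k; case: ifP.
congr (Q _); apply/seteqP; split => w /= Aw.
  by move=> k _; case: eqVneq => // ->.
by have := Aw i Logic.I; rewrite eqxx.
Qed.

Lemma ge0_integral_gauss_marginal (i : 'I_N) (f : R -> \bar R) :
  measurable_fun setT f -> (forall x, 0 <= f x)%E ->
  (\int[Q]_w f ((Z w : 'rV[R]_N) ord0 i) = \int[normal_prob 0 1]_x f x)%E.
Proof.
move=> mf f0.
pose Zi (w : T) : measurableTypeR R := (Z w : 'rV[R]_N) ord0 i.
have mZi : measurable_fun setT Zi by exact: mZ.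
pose law : {measure set _ -> \bar R} := pushforward Q Zi.
transitivity (\int[law mZi]_x f x)%E.
  by rewrite ge0_integral_pushforward.
by apply: eq_measure_integral => A mA _; exact: gauss_marginal.
Qed.

(** Viewing each coordinate as a vector along its axis makes [Z] a sum of [N] independent vectors,
    so the results on [psum] apply to the coordinates of a single Gaussian vector. *)
Let axis (i : 'I_N) (w : T) : rvec R N := (Z w : 'rV[R]_N) ord0 i *: unit_vec i.

Let maxis i : measurable_fun setT (axis i).
Proof.
apply/measurable_rvec => k; under eq_fun do rewrite mxE.
exact: measurable_funM.
Qed.

Let ind_axis : mutually_independent Q axis.
Proof.
move=> A mA.
pose B i := [set y : R | A i (y *: unit_vec i)].
have mB i : measurable (B i).
  have mi : measurable_fun setT (fun y : R => (y *: unit_vec i : rvec R N)).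
    by apply/measurable_rvec => k; under eq_fun do rewrite mxE; exact: measurable_funM.
  by rewrite -[B i]setTI; exact: (mi measurableT (A i) (mA i)).
case: gZ => _ /(_ _ mB) gB.
rewrite [LHS]gB; apply: eq_bigr => i _.
by rewrite -(gauss_marginal i (mB i)).
Qed.

Let psum_axis j w k :
  (psum axis j w : 'rV[R]_N) ord0 k = if (k < j)%N then (Z w : 'rV[R]_N) ord0 k else 0.
Proof.
rewrite /psum summxE; case: ifPn => kj.
  rewrite (bigD1 k)//= !mxE !eqxx mulr1 big1 ?addr0// => i /andP[_ ik].
  by rewrite !mxE eqxx/= eq_sym (negPf ik) mulr0.
rewrite big1// => i ij; rewrite !mxE eqxx/=.
by case: eqVneq => [ki|]; rewrite ?mulr0//; move: kj; rewrite ki ij.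
Qed.

Let psum_axis_all w : psum axis N w = Z w.
Proof. by apply/rowP => k; rewrite psum_axis ltn_ord. Qed.

Variables (a : R) (v : 'rV[R]_N).
Hypothesis a0 : 0 < a.

Let vpart (j : nat) : 'rV[R]_N := \sum_(i < N | (i < j)%N) v ord0 i *: unit_vec i.
Let dens (j : nat) (x : 'rV[R]_N) : R :=
  \prod_(i < N | (i < j)%N) shift_density a (v ord0 i) (x ord0 i).

Let shift_density_ge0 u x : 0 <= shift_density a u x.
Proof. by rewrite mulr_ge0 ?expR_ge0// invr_ge0 ltW. Qed.

Let dens_ge0 j x : 0 <= dens j x.
Proof. by apply: prodr_ge0. Qed.

Let mdens j : measurable_fun setT (dens j : rvec R N -> R).
Proof.
rewrite /dens; elim: (index_enum _) => [|i s IH].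
  by under eq_fun do rewrite big_nil; exact: measurable_cst.
under eq_fun do rewrite big_cons.
case: (i < j)%N => //; apply: measurable_funM => //.
exact: measurableT_comp (measurable_shift_density _ _) (measurable_coord i).
Qed.

(** Induction over the coordinates. The new coordinate is split off as an independent variable and
    transformed by the one-dimensional formula; after Tonelli the induction hypothesis is applied to
    the other coordinates with this one frozen, and a second exchange reassembles the integral. *)
Let gauss_affine_psum j (F : rvec R N -> \bar R) : (j <= N)%N ->
  measurable_fun setT F -> (forall x, 0 <= F x)%E ->
  (\int[Q]_w F (a *: (psum axis j w : 'rV[R]_N) + vpart j)%R =
   \int[Q]_w (F (psum axis j w) * (dens j (psum axis j w))%:E))%E.
Proof.
elim: j F => [|j IH] F jN mF F0.
  apply: eq_integral => w _.
  by rewrite psum0 /vpart big_pred0// addr0 scaler0 /dens big_pred0// mule1.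
pose jo := Ordinal jN.
pose e (x y : rvec R N) : rvec R N :=
  (a *: (x : 'rV[R]_N) + vpart j) + (a *: (y : 'rV[R]_N) + v ord0 jo *: unit_vec jo).
have me d1 (U : measurableType d1) (f g : U -> rvec R N) :
    measurable_fun setT f -> measurable_fun setT g ->
    measurable_fun setT (fun u => e (f u) (g u)).
  move=> mf mg; apply: measurable_rvecD; apply: measurable_rvecD => //;
    exact: measurable_rvecZ.
have eE w : a *: (psum axis j.+1 w : 'rV[R]_N) + vpart j.+1 =
    e (psum axis j w) (axis jo w).
  rewrite /e (psumS _ jo) scalerDr.
  have -> : vpart j.+1 = vpart j + v ord0 jo *: unit_vec jo.
    rewrite /vpart (bigD1 jo)//= addrC; congr (_ + _).
    by apply: eq_bigl => i; rewrite ltnS ltn_neqAle andbC.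
  by rewrite -!addrA; congr (_ + _); rewrite addrCA.
under eq_integral do rewrite eE.
rewrite (@ge0_integral_psum _ _ _ Q _ _ axis maxis ind_axis jo (fun p => F (e p.1 p.2)))//; last first.
  by apply: measurableT_comp mF _; apply: me; [exact: measurable_fst|exact: measurable_snd].
have mpax (d1 : measure_display) (U : measurableType d1) (f : U -> T) :
    measurable_fun setT f -> measurable_fun setT (fun u => psum axis j (f u)).
  by move=> mf; exact: measurableT_comp (measurable_psum maxis j) mf.
have max' (d1 : measure_display) (U : measurableType d1) (f : U -> T) :
    measurable_fun setT f -> measurable_fun setT (fun u => axis jo (f u)).
  by move=> mf; exact: measurableT_comp (maxis jo) mf.
have sd_m (d1 : measure_display) (U : measurableType d1) (f : U -> T) :
    measurable_fun setT f ->
    measurable_fun setT (fun u => shift_density a (v ord0 jo) ((Z (f u) : 'rV[R]_N) ord0 jo)).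
  move=> mf; apply: measurableT_comp; first exact: measurable_shift_density.
  exact: measurableT_comp (mZ jo) mf.
pose g (p : T * T) : \bar R :=
  (F (a *: (psum axis j p.1 : 'rV[R]_N) + vpart j + axis jo p.2)%R *
   (shift_density a (v ord0 jo) ((Z p.2 : 'rV[R]_N) ord0 jo))%:E)%E.
have mg : measurable_fun setT g.
  apply: emeasurable_funM; last by apply/measurable_EFinP; exact: sd_m.
  apply: measurableT_comp mF _; apply: measurable_rvecD; last exact: max'.
  by apply: measurable_rvecD => //; apply: measurable_rvecZ; exact: mpax.
have g0 p : (0 <= g p)%E by rewrite /g mule_ge0// lee_fin.
transitivity (\int[Q]_w \int[Q]_w' g (w, w'))%E.
  apply: eq_integral => w _.
  pose G c y : \bar R := F (c + y *: unit_vec jo)%R.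
  have mG c : measurable_fun setT (G c).
    apply: measurableT_comp mF _; apply: measurable_rvecD => //.
    by apply/measurable_rvec => k; under eq_fun do rewrite mxE; exact: measurable_funM.
  pose c := a *: (psum axis j w : 'rV[R]_N) + vpart j.
  transitivity (\int[Q]_w' G c (a * (Z w' : 'rV[R]_N) ord0 jo + v ord0 jo)%R)%E.
    apply: eq_integral => w' _; rewrite /G /e /axis /=; congr F; congr (_ + _).
    by rewrite scalerA scalerDl.
  rewrite (@ge0_integral_gauss_marginal jo (fun y => G c (a * y + v ord0 jo)%R))//; last 2 first.
    by apply: (measurableT_comp (mG c)); apply: measurable_funD => //; exact: measurable_funM.
    by move=> x; exact: F0.
  rewrite (ge0_integral_normal_affine _ a0 (mG c)); last by move=> x; exact: F0.
  rewrite -(ge0_integral_gauss_marginal jo)//; last first.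
    by move=> x; rewrite mule_ge0// ?lee_fin//; exact: F0.
  by apply: emeasurable_funM => //; apply/measurable_EFinP; exact: measurable_shift_density.
rewrite (fubini_tonelli g mg g0).
pose g' (p : T * T) : \bar R :=
  (F ((psum axis j p.1 : 'rV[R]_N) + axis jo p.2)%R * (dens j (psum axis j p.1))%:E *
   (shift_density a (v ord0 jo) ((Z p.2 : 'rV[R]_N) ord0 jo))%:E)%E.
have mg' : measurable_fun setT g'.
  apply: emeasurable_funM; last by apply/measurable_EFinP; exact: sd_m.
  apply: emeasurable_funM.
    apply: measurableT_comp mF _; apply: measurable_rvecD; first exact: mpax.
    exact: max'.
  by apply/measurable_EFinP; apply: measurableT_comp (mdens j) _; exact: mpax.
have g'0 p : (0 <= g' p)%E by rewrite /g' !mule_ge0// lee_fin.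
transitivity (\int[Q]_w' \int[Q]_w g' (w, w'))%E.
  apply: eq_integral => w' _; rewrite /g /g' /=.
  have mF' : measurable_fun setT (fun x : rvec R N => F ((x : 'rV[R]_N) + axis jo w')%R).
    by apply: measurableT_comp mF _; exact: measurable_rvecD.
  rewrite ge0_integralZr//; last 2 first.
  - apply: measurableT_comp mF' _; apply: measurable_rvecD => //.
    by apply: measurable_rvecZ; exact: mpax.
  - by rewrite lee_fin.
  rewrite [in RHS]ge0_integralZr//; last 3 first.
  - apply: emeasurable_funM; first by apply: measurableT_comp mF' _; exact: mpax.
    by apply/measurable_EFinP; apply: measurableT_comp (mdens j) _; exact: mpax.
  - by move=> w _; rewrite mule_ge0// lee_fin.
  - by rewrite lee_fin.
  by congr (_ * _)%E; apply: (IH _ (ltnW jN) mF').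
rewrite -(fubini_tonelli g' mg' g'0).
pose f (p : rvec R N * rvec R N) : \bar R :=
  (F ((p.1 : 'rV[R]_N) + p.2)%R * (dens j p.1)%:E *
   (shift_density a (v ord0 jo) ((p.2 : 'rV[R]_N) ord0 jo))%:E)%E.
have ZE w : (axis jo w : 'rV[R]_N) ord0 jo = (Z w : 'rV[R]_N) ord0 jo.
  by rewrite !mxE !eqxx mulr1.
transitivity (\int[Q]_w \int[Q]_w' f (psum axis j w, axis jo w'))%E.
  by apply: eq_integral => w _; apply: eq_integral => w' _; rewrite /f /= ZE.
rewrite -(@ge0_integral_psum _ _ _ Q _ _ axis maxis ind_axis jo f); last 2 first.
- apply: emeasurable_funM.
    apply: emeasurable_funM.
      by apply: measurableT_comp mF _; apply: measurable_rvecD;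
        [exact: measurable_fst|exact: measurable_snd].
    by apply/measurable_EFinP; exact: measurableT_comp (mdens j) measurable_fst.
  apply/measurable_EFinP; apply: measurableT_comp; first exact: measurable_shift_density.
  exact: measurableT_comp (measurable_coord jo) measurable_snd.
- by move=> p; rewrite !mule_ge0// lee_fin.
apply: eq_integral => w _; rewrite /f /= -(psumS _ jo) -muleA; congr (_ * _)%E.
rewrite -EFinM; congr (_%:E).
rewrite /dens [RHS](bigD1 jo)//= mulrC psum_axis ltnSn ZE; congr (_ * _).
apply: eq_big => [i|i ij]; first by rewrite ltnS ltn_neqAle andbC.
by rewrite !psum_axis ij ltnW.
Qed.

Lemma ge0_gauss_affine (F : rvec R N -> \bar R) :
  measurable_fun setT F -> (forall x, 0 <= F x)%E ->
  (\int[Q]_w F (a *: (Z w : 'rV[R]_N) + v)%R =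
   \int[Q]_w (F (Z w) *
     (\prod_(i < N) shift_density a (v ord0 i) ((Z w : 'rV[R]_N) ord0 i))%:E))%E.
Proof.
move=> mF F0; have := gauss_affine_psum (leqnn N) mF F0.
have -> : vpart N = v.
  apply/rowP => k; rewrite /vpart summxE (bigD1 k)//= !mxE !eqxx mulr1 big1 ?addr0//.
  by move=> i /andP[_ ik]; rewrite !mxE eqxx/= eq_sym (negPf ik) mulr0.
under eq_integral do rewrite psum_axis_all.
move=> ->; apply: eq_integral => w _; rewrite psum_axis_all /dens.
by congr (_ * _%:E)%E; apply: eq_bigl => i; rewrite ltn_ord.
Qed.

End gaussian_vector.

(** * Uniform distribution on the sphere *)

Section hyperbolic_cosine.
Context {R : realType}.
Implicit Types x y : R.

Definition cosh y : R := (expR y + expR (- y)) / 2.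

Let cosh_sum y n : R := \sum_(0 <= k < n) y ^+ k.*2 / (k.*2)`!%:R.

Let cosh_sumE y n :
  cosh_sum y n = (series (exp_coeff y) n.*2 + series (exp_coeff (- y)) n.*2) / 2.
Proof.
elim: n => [|n IH]; first by rewrite /cosh_sum /series/= !big_geq// addr0 mul0r.
rewrite /cosh_sum big_nat_recr//= -/(cosh_sum y n) IH /series/= doubleS !big_nat_recr//=.
rewrite /exp_coeff/=.
have e2 : (- y) ^+ n.*2 = y ^+ n.*2 by rewrite exprNn -signr_odd odd_double mul1r.
rewrite !exprS e2; field.
by rewrite !pnatr_eq0 -!lt0n !fact_gt0.
Qed.

Let cvg_cosh_sum y : cosh_sum y @ \oo --> cosh y.
Proof.
have cd : (fun n : nat => n.*2) @ \oo --> \oo.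
  move=> A [m _ mA]; exists m => // n /= mn; apply: mA => /=.
  by rewrite (leq_trans mn)// -addnn leq_addr.
rewrite (_ : cosh_sum y = fun n =>
  (series (exp_coeff y) n.*2 + series (exp_coeff (- y)) n.*2) / 2); last first.
  by apply/funext => n; rewrite cosh_sumE.
apply: cvgMl; apply: cvgD.
- exact: (cvg_comp _ _ cd (is_cvg_series_exp_coeff y)).
- exact: (cvg_comp _ _ cd (is_cvg_series_exp_coeff (- y))).
Qed.

Let nd_cosh_sum y : nondecreasing_seq (cosh_sum y).
Proof.
apply/nondecreasing_seqP => n; rewrite /cosh_sum big_nat_recr//= lerDl.
by rewrite divr_ge0// -mul2n exprM exprn_ge0// sqr_ge0.
Qed.

Lemma cosh_ge y : 1 + y ^+ 2 / 2 <= cosh y.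
Proof.
have <- : limn (cosh_sum y) = cosh y by apply: cvg_lim => //; exact: cvg_cosh_sum.
have cv : cvgn (cosh_sum y) by apply/cvg_ex; exists (cosh y); exact: cvg_cosh_sum.
have := nondecreasing_cvgn_le (@nd_cosh_sum y) cv 2%N.
by rewrite {1}/cosh_sum !big_nat_recr//= big_geq// add0r expr0 fact0 divr1.
Qed.

Lemma cosh_ge1 y : 1 <= cosh y.
Proof. by rewrite (le_trans _ (cosh_ge y))// lerDl divr_ge0// sqr_ge0. Qed.

(** Termwise comparison of the power series, by 2^k k! <= (2 k)!. *)
Lemma cosh_le y : cosh y <= expR (y ^+ 2 / 2).
Proof.
have <- : limn (cosh_sum y) = cosh y by apply: cvg_lim => //; exact: cvg_cosh_sum.
apply: limr_le; first by apply/cvg_ex; exists (cosh y); exact: cvg_cosh_sum.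
near=> n; apply: (@le_trans _ _ (series (exp_coeff (y ^+ 2 / 2)) n)).
  rewrite /cosh_sum /series/=; apply: ler_sum => k _; rewrite /exp_coeff/=.
  rewrite -mul2n exprM expr_div_n -mulrA ler_wpM2l//.
    by rewrite exprn_ge0 ?sqr_ge0.
  rewrite -invfM lef_pV2 ?posrE ?mulr_gt0 ?exprn_gt0 ?ltr0n ?fact_gt0//.
  rewrite -natrX -natrM ler_nat.
  elim: k => // k IH; rewrite mulnS 2!factS factS expnS.
  apply: (@leq_trans (((2 * k).+2 * (2 * k).+1) * (2 ^ k * k`!))).
    rewrite (_ : 2 * 2 ^ k * _ = (2 * k.+1 * 1) * (2 ^ k * k`!))%N; last first.
      by rewrite muln1 -!mulnA; congr (_ * _)%N; rewrite mulnCA.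
    by rewrite leq_mul2r leq_mul ?orbT// mulnS.
  by rewrite -mulnA leq_mul2l leq_mul2l IH.
apply: nondecreasing_cvgn_le; last exact: is_cvg_series_exp_coeff.
apply: nondecreasing_series => k _ _; apply: exp_coeff_ge0.
by rewrite divr_ge0// sqr_ge0.
Unshelve. all: by end_near. Qed.

End hyperbolic_cosine.

Lemma prod_cosh_bounds (R : realType) (N : nat) (y : 'I_N -> R) :
  1 + (\sum_i y i ^+ 2) / 2 <= \prod_i cosh (y i) <= expR ((\sum_i y i ^+ 2) / 2).
Proof.
apply/andP; split.
  (* The bound 1 <= is carried along because products b e satisfy b e >= b + e - 1 when both factors
     are at least 1. *)
  suff : 1 + (\sum_i y i ^+ 2) / 2 <= \prod_i cosh (y i) /\ 1 <= \prod_i cosh (y i).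
    by case.
  elim/big_ind2 : _ => [|a b c e [ab b1] [ce e1]|i _]; first by rewrite mul0r addr0.
  - split; last by rewrite -[1]mulr1 ler_pM.
    by nra.
  - by split; [exact: cosh_ge|exact: cosh_ge1].
rewrite mulr_suml expR_sum; apply: ler_prod => i _.
by rewrite cosh_le andbT (le_trans ler01)// cosh_ge1.
Qed.

(** * Euclidean geometry and reflections *)

Section reflections.
Context {R : realType} {N : nat}.
Implicit Types u v x y : 'rV[R]_N.

Lemma dotpE x y : dotp x y = (x *m y^T) 0 0.
Proof. by rewrite mxE; apply: eq_bigr => i _; rewrite mxE. Qed.

Lemma dotpC x y : dotp x y = dotp y x.
Proof. by apply: eq_bigr => i _; rewrite mulrC. Qed.

Lemma dotpDl x y z : dotp (x + y) z = dotp x z + dotp y z.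
Proof. by rewrite -big_split; apply: eq_bigr => i _; rewrite mxE mulrDl. Qed.

Lemma dotpDr x y z : dotp x (y + z) = dotp x y + dotp x z.
Proof. by rewrite dotpC dotpDl !(dotpC _ x). Qed.

Lemma dotpZl a x y : dotp (a *: x) y = a * dotp x y.
Proof. by rewrite mulr_sumr; apply: eq_bigr => i _; rewrite mxE mulrA. Qed.

Lemma dotpZr a x y : dotp x (a *: y) = a * dotp x y.
Proof. by rewrite dotpC dotpZl dotpC. Qed.

Lemma dotpZZ a x : dotp (a *: x) (a *: x) = a ^+ 2 * dotp x x.
Proof. by rewrite dotpZl dotpZr mulrA expr2. Qed.

Lemma dotpNr x y : dotp x (- y) = - dotp x y.
Proof. by rewrite -scaleN1r dotpZr mulN1r. Qed.

Lemma dotpNl x y : dotp (- x) y = - dotp x y.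
Proof. by rewrite dotpC dotpNr dotpC. Qed.

Lemma dotp0r x : dotp x 0 = 0.
Proof. by rewrite -(scale0r 0) dotpZr mul0r. Qed.

Lemma dotp_sumr I (s : seq I) (p : pred I) x (f : I -> 'rV[R]_N) :
  dotp x (\sum_(i <- s | p i) f i) = \sum_(i <- s | p i) dotp x (f i).
Proof. by elim/big_rec2 : _ => [|i a b _ <-]; rewrite ?dotp0r// dotpDr. Qed.

Lemma dotp_ge0 x : 0 <= dotp x x.
Proof. by apply: sumr_ge0 => i _; rewrite -expr2 sqr_ge0. Qed.

Lemma dotp_eq0 x : dotp x x = 0 -> x = 0.
Proof.
move=> x0; apply/rowP => i; rewrite mxE; apply/eqP; rewrite -sqrf_eq0 expr2.
move/eqP : x0; rewrite psumr_eq0 => [/allP/(_ i)|k _]; last by rewrite -expr2 sqr_ge0.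
by rewrite mem_index_enum => /(_ erefl).
Qed.

Lemma enorm_sqr x : enorm x ^+ 2 = dotp x x.
Proof. by rewrite sqr_sqrtr// dotp_ge0. Qed.

Lemma enorm_ge0 x : 0 <= enorm x.
Proof. exact: sqrtr_ge0. Qed.

Lemma dotp_le x y : dotp x y <= enorm x * enorm y.
Proof.
have [x0|x0] := eqVneq (enorm x) 0.
  have -> : x = 0 by apply: dotp_eq0; rewrite -enorm_sqr x0 expr0n.
  by rewrite dotpC dotp0r mulr_ge0// enorm_ge0.
have := dotp_ge0 (enorm y *: x - enorm x *: y).
rewrite dotpDl !dotpDr -scaleNr !dotpZl !dotpZr -!enorm_sqr (dotpC y x).
have xp : 0 < enorm x by rewrite lt_def x0 enorm_ge0.
have [y0|y0] := eqVneq (enorm y) 0.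
  have -> : y = 0 by apply: dotp_eq0; rewrite -enorm_sqr y0 expr0n.
  by rewrite dotp0r mulr_ge0// enorm_ge0.
have yp : 0 < enorm y by rewrite lt_def y0 enorm_ge0.
move=> h; rewrite -subr_ge0 -(pmulr_rge0 _ (mulr_gt0 xp yp)).
by nra.
Qed.

Lemma enormZ a x : enorm (a *: x) = `|a| * enorm x.
Proof.
by rewrite /enorm dotpZl dotpZr mulrA -expr2 sqrtrM ?sqr_ge0// sqrtr_sqr.
Qed.

Lemma enorm_dotpDl x y : enorm (x + y) ^+ 2 = enorm x ^+ 2 + 2 * dotp x y + enorm y ^+ 2.
Proof. by rewrite !enorm_sqr dotpDl !dotpDr (dotpC y x); ring. Qed.

Lemma enormD x y : enorm (x + y) <= enorm x + enorm y.
Proof.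
rewrite -(@ler_pXn2r _ 2)// ?nnegrE ?addr_ge0 ?enorm_ge0// enorm_dotpDl.
by have := dotp_le x y; nra.
Qed.

Lemma coord_le_enorm x i : `|x ord0 i| <= enorm x.
Proof.
rewrite -sqrtr_sqr ler_sqrt ?dotp_ge0// /dotp (bigD1 i)//= -expr2 lerDl.
by apply: sumr_ge0 => k _; rewrite -expr2 sqr_ge0.
Qed.

(** The Householder reflection in the hyperplane orthogonal to [u - v] exchanges two vectors of
    equal norm; for [u = v] the identity serves. *)
Lemma orthogonal_transitive u v : dotp u u = dotp v v ->
  exists2 O : 'M[R]_N, O *m O^T = 1%:M & u *m O = v.
Proof.
move=> uv; have [w wE] : exists w, w = u - v by exists (u - v).
have [w0|w0] := eqVneq (dotp w w) 0.
  exists 1%:M; first by rewrite mul1mx trmx1.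
  by rewrite mulmx1; apply/eqP; rewrite -subr_eq0 -wE; apply/eqP/dotp_eq0.
pose k := 2 / dotp w w.
have [A AE] : exists A : 'M[R]_N, A = w^T *m w by eexists.
have ww : w *m w^T = (dotp w w)%:M by rewrite [LHS]mx11_scalar -dotpE.
have AA : A *m A = dotp w w *: A.
  by rewrite AE mulmxA -(mulmxA w^T) ww mul_mx_scalar -scalemxAl.
have AT : A^T = A by rewrite AE trmx_mul trmxK.
exists (1%:M - k *: A).
  have -> : (1%:M - k *: A)^T = 1%:M - k *: A.
    by rewrite [LHS]linearB/= trmx1 [X in _ - X]linearZ/= AT.
  rewrite mulmxBl mul1mx mulmxBr mulmx1.
  rewrite -scalemxAl -scalemxAr AA !scalerA.
  have -> : k * k * dotp w w = k + k by rewrite /k; field.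
  by rewrite scalerDl opprB addrK subrK.
rewrite mulmxBr mulmx1 -scalemxAr AE mulmxA.
have -> : u *m w^T = (dotp u w)%:M by rewrite [LHS]mx11_scalar -dotpE.
rewrite mul_scalar_mx scalerA.
have -> : k * dotp u w = 1.
  have -> : dotp u w = dotp w w / 2.
    rewrite wE !(dotpDl, dotpDr, dotpNl, dotpNr) -uv (dotpC v u).
    by field.
  by rewrite /k; field.
by rewrite scale1r wE opprB addrC subrK.
Qed.

End reflections.

(** * Integrability of real functions on a probability space *)

Lemma bounded_integrable (R : realType) d (T : measurableType d)
    (P : probability T R) (f : T -> R) (K : R) :
  measurable_fun setT f -> (forall w, `|f w| <= K) ->
  P.-integrable setT (EFin \o f).
Proof.
move=> mf fK; apply: measurable_bounded_integrable => //.
  by apply: le_lt_trans (probability_le1 _ _) (ltry _).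
exists K; split; first by rewrite num_real.
by move=> x Kx w _; exact: (le_trans (fK w) (ltW Kx)).
Qed.

Section real_integrable.
Context {R : realType} d (T : measurableType d) (P : probability T R).
Implicit Types f g : T -> R.
Notation integrable f := (P.-integrable setT (EFin \o f)).

Lemma integrable_addr f g : integrable f -> integrable g ->
  integrable (fun w => f w + g w).
Proof.
by move=> fi gi; apply: eq_integrable (integrableD measurableT fi gi).
Qed.

Lemma integrable_subr f g : integrable f -> integrable g ->
  integrable (fun w => f w - g w).
Proof.
by move=> fi gi; apply: eq_integrable (integrableB measurableT fi gi).
Qed.

Lemma integrable_mulrl (c : R) f : integrable f -> integrable (fun w => c * f w).
Proof.
by move=> fi; apply: eq_integrable (integrableZl measurableT c fi).
Qed.

Lemma integrable_le f g : measurable_fun setT f -> integrable g ->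
  (forall w, `|f w| <= g w) -> integrable f.
Proof.
move=> mf gi fg; apply: le_integrable gi => //; first exact/measurable_EFinP.
by move=> w _ /=; rewrite lee_fin (le_trans (fg w))// ler_norm.
Qed.

Lemma integrable_measurable f : integrable f -> measurable_fun setT f.
Proof. by move=> /measurable_int /measurable_EFinP. Qed.

Lemma integrable_cst (c : R) : integrable (fun=> c).
Proof. exact: finite_measure_integrable_cst. Qed.

End real_integrable.

Lemma Rintegral_cstT (R : realType) d (T : measurableType d)
    (P : probability T R) (r : R) : \int[P]_w r = r.
Proof.
rewrite Rintegral_cst// -[RHS]mulr1; congr (r * _).
by rewrite -[RHS]/(fine 1); congr fine; exact: probability_setT.
Qed.

(** * Moment generating function of a uniform spin *)

Section sphere.
Context {R : realType} d (T : measurableType d) (P : probability T R).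
Context {N : nat} (X : T -> rvec R N).
Hypothesis N0 : (0 < N)%N.
Hypothesis mX : measurable_fun setT X.
Hypothesis nX : forall w, dotp (X w) (X w) = 1.
Hypothesis invX : forall O : 'M[R]_N, O *m O^T = 1%:M ->
  forall A : set (rvec R N), measurable A ->
  P (X @^-1` A) = P ((fun w => (X w : 'rV[R]_N) *m O) @^-1` A).

Let enormX w : enorm (X w) = 1.
Proof. by rewrite /enorm nX sqrtr1. Qed.

Lemma Rintegral_rotate (O : 'M[R]_N) (F : rvec R N -> R) :
  O *m O^T = 1%:M -> measurable_fun setT F -> (forall x, 0 <= F x) ->
  \int[P]_w F (X w) = \int[P]_w F ((X w : 'rV[R]_N) *m O).
Proof.
move=> OO mF F0; congr fine.
pose XO w : rvec R N := (X w : 'rV[R]_N) *m O.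
have mXO : measurable_fun setT XO by exact: measurable_rvecM.
have mF' : measurable_fun setT (EFin \o F) by exact/measurable_EFinP.
have F'0 x : (0 <= (EFin \o F) x)%E by rewrite lee_fin.
transitivity (\int[distribution P (mfun_Sub (mem_set mX))]_x (EFin \o F) x)%E.
  by rewrite ge0_integral_distribution.
transitivity (\int[distribution P (mfun_Sub (mem_set mXO))]_x (EFin \o F) x)%E.
  by apply: eq_measure_integral => A mA _; exact: invX.
by rewrite ge0_integral_distribution.
Qed.

Definition mgf (t : 'rV[R]_N) : R := \int[P]_w expR (dotp t (X w)).

Let mdotp (t : 'rV[R]_N) : measurable_fun setT (fun x : rvec R N => dotp t x).
Proof. by apply: measurable_dotp => //; exact: measurable_cst. Qed.

Lemma integrable_expR_dotp t : P.-integrable setT (EFin \o (fun w => expR (dotp t (X w)))).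
Proof.
apply: (@bounded_integrable _ _ _ _ _ (expR (enorm t))).
  apply: measurableT_comp => //; exact: measurableT_comp (mdotp t) mX.
by move=> w; rewrite ger0_norm ?expR_ge0// ler_expR (le_trans (dotp_le _ _))// enormX mulr1.
Qed.

Lemma mgf_le_expR_enorm t : mgf t <= expR (enorm t).
Proof.
have -> : expR (enorm t) = \int[P]_w expR (enorm t).
  by rewrite Rintegral_cstT.
apply: le_Rintegral => //; first exact: integrable_expR_dotp.
  exact: finite_measure_integrable_cst.
by move=> w _; rewrite ler_expR (le_trans (dotp_le _ _))// enormX mulr1.
Qed.

(* By rotation [t] may be replaced by the constant vector of the same norm; flipping the
   signs of the coordinates one after the other then turns [exp] into a product of [cosh]. *)
Let half_flipped (c : R) (j : nat) (x : 'rV[R]_N) : R :=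
  \prod_(i < N) (if (i < j)%N then cosh (c * x ord0 i) else expR (c * x ord0 i)).

Let cosh_gt0 (y : R) : 0 < cosh y.
Proof. by rewrite (lt_le_trans _ (cosh_ge1 y)). Qed.

Let factor_ge0 (c : R) j (x : 'rV[R]_N) (i : 'I_N) :
  0 <= (if (i < j)%N then cosh (c * x ord0 i) else expR (c * x ord0 i)).
Proof. by case: ifP => _; rewrite ?expR_ge0// ltW. Qed.

Let half_flipped_ge0 c j x : 0 <= half_flipped c j x.
Proof. by apply: prodr_ge0 => i _; exact: factor_ge0. Qed.

Let measurable_half_flipped c j : measurable_fun setT (half_flipped c j : rvec R N -> R).
Proof.
apply: measurable_prod => i _.
have m1 (a : R) : measurable_fun setT (fun x : rvec R N => expR (a * (x : 'rV[R]_N) ord0 i)).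
  apply: measurableT_comp => //; apply: measurable_funM => //.
  exact: measurable_coord.
case: (i < j)%N => //; apply: measurable_funM => //; apply: measurable_funD => //.
by under eq_fun do rewrite -mulNr; exact: m1.
Qed.

Let half_flipped_le c j w : half_flipped c j (X w) <= expR `|c| ^+ N.
Proof.
rewrite -[N in _ ^+ N]card_ord -prodr_const; apply: ler_prod => i _.
rewrite factor_ge0/=.
have h : `|c * (X w : 'rV[R]_N) ord0 i| <= `|c|.
  by rewrite normrM ler_piMr// (le_trans (coord_le_enorm _ _))// enormX.
have [h1 h2] := (ler_normlW h, lerNnormlW h).
case: ifP => _; last by rewrite ler_expR.
by rewrite /cosh ler_pdivrMr// mulr_natr mulr2n lerD// ler_expR// lerNl.
Qed.

Let integrable_half_flipped c j :
  P.-integrable setT (EFin \o (fun w => half_flipped c j (X w))).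
Proof.
apply: (@bounded_integrable _ _ _ _ _ (expR `|c| ^+ N)).
  exact: measurableT_comp (measurable_half_flipped c j) mX.
by move=> w; rewrite ger0_norm.
Qed.

Let flip_step c (j : 'I_N) :
  \int[P]_w half_flipped c j (X w) = \int[P]_w half_flipped c j.+1 (X w).
Proof.
pose D : 'rV[R]_N := \row_i (if i == j then -1 else 1).
have DD : diag_mx D *m (diag_mx D)^T = 1%:M.
  rewrite tr_diag_mx mulmx_diag -diag_const_mx; congr diag_mx.
  by apply/rowP => i; rewrite !mxE; case: ifP; rewrite ?mulrNN mulr1.
have XD w i : ((X w : 'rV[R]_N) *m diag_mx D) ord0 i =
    if i == j then - (X w : 'rV[R]_N) ord0 i else (X w : 'rV[R]_N) ord0 i.
  by rewrite mul_mx_diag !mxE; case: ifP; rewrite ?mulrN mulr1.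
have e := Rintegral_rotate DD (measurable_half_flipped c j) (half_flipped_ge0 c j).
pose F w := half_flipped c j ((X w : 'rV[R]_N) *m diag_mx D).
have FE w : half_flipped c j.+1 (X w) = (half_flipped c j (X w) + F w) * 2^-1.
  rewrite /F /half_flipped (bigD1 j)//= [in RHS](bigD1 j)//=.
  rewrite [X in _ = (_ + X) * _](bigD1 j)//= ltnSn ltnn XD eqxx mulrN.
  set p := \prod_(i | _) _; set q := \prod_(i | _) _; set r := \prod_(i | _) _.
  have -> : q = p.
    apply: eq_bigr => i ij; rewrite ltnS [in RHS]leq_eqVlt.
    by rewrite (_ : (i == j :> nat) = false)//; apply/negbTE; rewrite -val_eqE in ij.
  have -> : r = p.
    apply: eq_bigr => i ij; rewrite ltnS [in RHS]leq_eqVlt XD (negPf ij).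
    by rewrite (_ : (i == j :> nat) = false)//; apply/negbTE; rewrite -val_eqE in ij.
  by rewrite /cosh; field.
have iF : P.-integrable setT (EFin \o F).
  apply: (@bounded_integrable _ _ _ _ _ (expR `|c| ^+ N * 2)).
    apply: measurableT_comp (measurable_half_flipped c j) _; exact: measurable_rvecM.
  move=> w; rewrite ger0_norm; last exact: half_flipped_ge0.
  (* By [FE], [F] is a nonnegative summand of twice [half_flipped c j.+1], which is already
     bounded. *)
  have := half_flipped_le c j.+1 w; rewrite FE -ler_pdivlMr ?invr_gt0// invrK.
  by apply: le_trans; rewrite lerDr.
transitivity (\int[P]_w ((half_flipped c j (X w) + F w) * 2^-1)); last first.
  by apply: eq_Rintegral => w _; rewrite FE.
rewrite RintegralZr//; last exact: integrable_addr.
by rewrite RintegralD// /F -e; field.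
Qed.

Let mgf_prod_cosh c :
  mgf (const_mx c) = \int[P]_w \prod_(i < N) cosh (c * (X w : 'rV[R]_N) ord0 i).
Proof.
have h j : (j <= N)%N -> \int[P]_w half_flipped c 0 (X w) = \int[P]_w half_flipped c j (X w).
  elim: j => // j IH jN; rewrite IH ?(ltnW jN)//.
  exact: (flip_step c (Ordinal jN)).
transitivity (\int[P]_w half_flipped c 0 (X w)).
  apply: eq_Rintegral => w _; rewrite /half_flipped /dotp expR_sum.
  by apply: eq_bigr => i _; rewrite mxE.
rewrite (h N)//; apply: eq_Rintegral => w _; apply: eq_bigr => i _.
by rewrite ltn_ord.
Qed.

(** For the constant vector with entries c = |t| / sqrt N, the arguments c X_i of the hyperbolic
    cosines have squares summing to |t|^2 / N at every point of the sphere. Both bounds of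
    [prod_cosh_bounds] are then constants, and hold before integration. *)
Lemma mgf_bounds t :
  1 + dotp t t / (2 * N%:R) <= mgf t <= expR (dotp t t / (2 * N%:R)).
Proof.
pose c := enorm t / Num.sqrt N%:R.
have N0' : 0 < N%:R :> R by rewrite ltr0n.
have cE : c ^+ 2 * N%:R = dotp t t.
  by rewrite expr_div_n enorm_sqr sqr_sqrtr ?ltW// divfK// gt_eqF.
have tc : dotp t t = dotp (const_mx c : 'rV[R]_N) (const_mx c).
  rewrite -cE mulr_natr -[in LHS](card_ord N) -sumr_const.
  by apply: eq_bigr => i _; rewrite !mxE expr2.
have [M MM tM] := orthogonal_transitive (esym tc).
have -> : mgf t = mgf (const_mx c).
  rewrite /mgf; have MM' : M^T *m (M^T)^T = 1%:M by rewrite trmxK; exact: mulmx1C.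
  have mF : measurable_fun setT (fun x : rvec R N => expR (dotp (const_mx c) x)).
    exact: measurableT_comp.
  rewrite (Rintegral_rotate MM' mF)//; apply: eq_Rintegral => w _; congr expR.
  by rewrite !dotpE -tM trmx_mul trmxK mulmxA.
rewrite mgf_prod_cosh.
have bd w : 1 + dotp t t / (2 * N%:R) <= \prod_(i < N) cosh (c * (X w : 'rV[R]_N) ord0 i)
    <= expR (dotp t t / (2 * N%:R)).
  have := prod_cosh_bounds (fun i => c * (X w : 'rV[R]_N) ord0 i).
  have -> // : (\sum_(i < N) (c * (X w : 'rV[R]_N) ord0 i) ^+ 2) / 2 = dotp t t / (2 * N%:R).
  under eq_bigr do rewrite exprMn.
  rewrite -mulr_sumr (_ : \sum_i _ = 1) ?mulr1 -?cE; first by field; rewrite gt_eqF.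
  by rewrite -(nX w); apply: eq_bigr => i _; rewrite expr2.
have ip : P.-integrable setT
    (EFin \o (fun w => \prod_(i < N) cosh (c * (X w : 'rV[R]_N) ord0 i))).
  have := integrable_half_flipped c N; apply: eq_integrable => // w _ /=.
  by congr EFin; apply: eq_bigr => i _; rewrite ltn_ord.
apply/andP; split.
  rewrite -[leLHS](Rintegral_cstT P); apply: le_Rintegral => //.
    exact: integrable_cst.
  by move=> w _; have /andP[] := bd w.
rewrite -[leRHS](Rintegral_cstT P); apply: le_Rintegral => //.
  exact: integrable_cst.
by move=> w _; have /andP[] := bd w.
Qed.

End sphere.

(** * Gaussian and iterated integrals *)

Section gaussian_integrals.
Context {R : realType} d (T : measurableType d) (Q : probability T R).
Context {N : nat} (Z : T -> rvec R N).
Hypothesis gZ : std_gaussian_rv Q Z.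
Implicit Types F : rvec R N -> R.

Let mZ : measurable_fun setT Z.
Proof. exact: measurable_gauss gZ. Qed.

Let density (a : R) (v : 'rV[R]_N) w : R :=
  \prod_(i < N) shift_density a (v ord0 i) ((Z w : 'rV[R]_N) ord0 i).

Let density_ge0 a v w : 0 < a -> 0 <= density a v w.
Proof.
by move=> a0; apply: prodr_ge0 => i _; rewrite mulr_ge0 ?expR_ge0// invr_ge0 ltW.
Qed.

Let densityE a v w : 0 < a -> density a v w =
  (a ^+ N)^-1 * expR (dotp (Z w) (Z w) / 2 -
    dotp ((Z w : 'rV[R]_N) - v) ((Z w : 'rV[R]_N) - v) / (2 * a ^+ 2)).
Proof.
move=> a0; rewrite /density big_split/= prodr_const card_ord exprVn; congr (_ * _).
rewrite -expR_sum; congr expR; rewrite big_split/= sumrN -!mulr_suml.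
congr (_ / _ - _ / _).
by apply: eq_bigr => i _; rewrite !mxE expr2.
Qed.

(** Positive and negative parts are transformed separately, so integrability need not be settled
    before changing variables. *)
Let Rintegral_gauss_affine a v F : 0 < a -> measurable_fun setT F ->
  \int[Q]_w F (a *: (Z w : 'rV[R]_N) + v) = \int[Q]_w (F (Z w) * density a v w).
Proof.
move=> a0 mF; congr fine; rewrite [LHS]integralE [RHS]integralE.
have mF' : measurable_fun setT (EFin \o F) by exact/measurable_EFinP.
have pos0 x : (0 <= (EFin \o F)^\+ x)%E by rewrite funepos_ge0.
have neg0 x : (0 <= (EFin \o F)^\- x)%E by rewrite funeneg_ge0.
congr (_ - _)%E.
- transitivity (\int[Q]_w (EFin \o F)^\+ (a *: (Z w : 'rV[R]_N) + v)%R)%E.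
    by apply: eq_integral => w _; rewrite !funeposE.
  rewrite (ge0_gauss_affine gZ v a0 (measurable_funepos mF') pos0).
  apply: eq_integral => w _; rewrite !funeposE /= -/(density a v w) -!EFin_max -EFinM.
  by rewrite maxr_pMl ?mul0r// density_ge0.
- transitivity (\int[Q]_w (EFin \o F)^\- (a *: (Z w : 'rV[R]_N) + v)%R)%E.
    by apply: eq_integral => w _; rewrite !funenegE.
  rewrite (ge0_gauss_affine gZ v a0 (measurable_funeneg mF') neg0).
  apply: eq_integral => w _; rewrite !funenegE /= -/(density a v w) -!EFin_max -EFinM.
  by rewrite maxr_pMl ?mul0r ?mulNr// density_ge0.
Qed.

Lemma gauss_shift (v : 'rV[R]_N) F : measurable_fun setT F ->
  \int[Q]_w F ((Z w : 'rV[R]_N) + v) =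
  \int[Q]_w (F (Z w) * expR (dotp v (Z w) - dotp v v / 2)).
Proof.
move=> mF; have := Rintegral_gauss_affine v ltr01 mF.
transitivity (\int[Q]_w F (1 *: (Z w : 'rV[R]_N) + v)).
  by apply: eq_Rintegral => w _; rewrite scale1r.
rewrite H; apply: eq_Rintegral => w _; rewrite densityE// expr1n invr1 mul1r.
congr (_ * expR _); rewrite !(dotpDl, dotpDr, dotpNl, dotpNr) expr1n (dotpC _ v).
by field.
Qed.

Lemma gauss_scale (a : R) F : 0 < a -> measurable_fun setT F ->
  \int[Q]_w F (a *: (Z w : 'rV[R]_N)) =
  \int[Q]_w (F (Z w) * ((a ^+ N)^-1 * expR ((1 - a ^- 2) / 2 * dotp (Z w) (Z w)))).
Proof.
move=> a0 mF; have h := Rintegral_gauss_affine 0 a0 mF.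
transitivity (\int[Q]_w F (a *: (Z w : 'rV[R]_N) + 0)).
  by apply: eq_Rintegral => w _; rewrite addr0.
rewrite h; apply: eq_Rintegral => w _; rewrite densityE// subr0.
congr (_ * (_ * expR _)); field; exact: lt0r_neq0.
Qed.

(** The value (1 - c)^(-N/2) of the Gaussian moment E exp (c |Z|^2 / 2), finite for c < 1. *)
Definition gauss_mass (c : R) : R := Num.sqrt ((1 - c)^-1) ^+ N.

(** The density of a Gaussian vector of variance 1 / (1 - c) has total mass one: this is the affine
    change of variables applied to the constant function 1. The integral is kept in the extended
    reals since its finiteness is also what integrability requires. *)
Let gauss_exp_mass (c : R) : c < 1 ->
  (\int[Q]_w (expR (c / 2 * dotp (Z w) (Z w)))%:E)%E = (gauss_mass c)%:E.
Proof.
move=> c1; pose a := Num.sqrt ((1 - c)^-1).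
have a0 : 0 < a by rewrite sqrtr_gt0 invr_gt0 subr_gt0.
have a2 : a ^- 2 = 1 - c by rewrite sqr_sqrtr ?invrK// invr_ge0 subr_ge0 ltW.
have h := @ge0_gauss_affine _ _ _ Q N Z gZ a 0 a0 (cst 1%E) (measurable_cst _) (fun=> lee01).
have e : (1 = ((a ^+ N)^-1)%:E * \int[Q]_w (expR (c / 2 * dotp (Z w) (Z w)))%:E)%E.
  rewrite -ge0_integralZl//; last 2 first.
  - apply/measurable_EFinP/measurableT_comp => //; apply: measurable_funM => //.
    exact: measurable_dotp.
  - by rewrite lee_fin invr_ge0 exprn_ge0 ?ltW.
  transitivity (\int[Q]_w (cst 1%E (a *: (Z w : 'rV[R]_N) + 0)%R))%E.
    by rewrite /= integral_cst// mul1e; apply/esym; exact: probability_setT.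
  rewrite h; apply: eq_integral => w _; rewrite mul1e -/(density a 0 w) densityE// subr0.
  rewrite -EFinM; congr (_ * expR _)%:E.
  have -> : c = 1 - a ^- 2 by rewrite a2 opprB addrCA subrr addr0.
  by field; exact: lt0r_neq0.
rewrite -[LHS]mul1e -[X in (X%:E * _)%E = _](@divff _ (a ^+ N)); last first.
  by rewrite expf_neq0// gt_eqF.
by rewrite EFinM -muleA -e mule1.
Qed.

Lemma integrable_gauss_exp (c : R) : c < 1 ->
  Q.-integrable setT (EFin \o (fun w => expR (c / 2 * dotp (Z w) (Z w)))).
Proof.
move=> c1; apply/integrableP; split.
  apply/measurable_EFinP/measurableT_comp => //; apply: measurable_funM => //.
  exact: measurable_dotp.
under eq_integral do rewrite /= ger0_norm ?expR_ge0//.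
by rewrite gauss_exp_mass// ltry.
Qed.

Lemma gauss_exp (c : R) : c < 1 ->
  \int[Q]_w expR (c / 2 * dotp (Z w) (Z w)) = gauss_mass c.
Proof. by move=> c1; rewrite /Rintegral gauss_exp_mass. Qed.

End gaussian_integrals.
Arguments gauss_mass {R} N c.

Section iterated_integrals.
Context {R : realType} d1 (T1 : measurableType d1) d2 (T2 : measurableType d2).
Context (P : probability T1 R) (Q : probability T2 R).

Lemma measurable_Rintegral (f : T1 * T2 -> R) : measurable_fun setT f ->
  measurable_fun setT (fun x => \int[Q]_y f (x, y)).
Proof.
move=> mf; apply: measurableT_comp => //.
have mf' : measurable_fun setT (EFin \o f) by exact/measurable_EFinP.
rewrite (_ : (fun x => _) = (fun x => \int[Q]_y (EFin \o f)^\+ (x, y) -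
    \int[Q]_y (EFin \o f)^\- (x, y))%E); last first.
  apply/funext => x; rewrite integralE.
  by congr (_ - _)%E; apply: eq_integral => y _; rewrite ?funeposE ?funenegE.
apply: emeasurable_funB.
- by apply: measurable_fun_fubini_tonelli_F => //; exact: measurable_funepos.
- by apply: measurable_fun_fubini_tonelli_F => //; exact: measurable_funeneg.
Qed.

(** A dominating function of the second variable alone suits a bounded spin paired with an
    integrable Gaussian weight. *)
Lemma Rintegral_Fubini (f : T1 * T2 -> R) (g : T2 -> R) :
  measurable_fun setT f -> Q.-integrable setT (EFin \o g) ->
  (forall x y, `|f (x, y)| <= g y) ->
  \int[P]_x \int[Q]_y f (x, y) = \int[Q]_y \int[P]_x f (x, y).
Proof.
move=> mf gi fg.
have mf' : measurable_fun setT (EFin \o f) by exact/measurable_EFinP.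
have fi x : Q.-integrable setT (EFin \o (fun y => f (x, y))).
  by apply: integrable_le gi _ => //; exact: measurableT_comp mf (pair1_measurable _).
have fi' y : P.-integrable setT (EFin \o (fun x => f (x, y))).
  apply: (@bounded_integrable _ _ _ _ _ (g y)) => //.
  exact: measurableT_comp mf (pair2_measurable _).
have ig : (P \x Q)%E.-integrable setT (EFin \o f).
  apply/integrable12ltyP => //.
  apply: (@le_lt_trans _ _ (\int[P]_x \int[Q]_y (EFin \o g) y)%E).
    apply: ge0_le_integral => //.
    - by move=> x _; apply: integral_ge0.
    - apply: (@measurable_fun_fubini_tonelli_F _ _ _ _ _ Q (abse \o (EFin \o f))).
        by apply: measurableT_comp.
      by move=> p /=; rewrite lee_fin.
    - move=> x _; apply: ge0_le_integral => //.
      + apply/measurable_EFinP/measurableT_comp => //.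
        exact: integrable_measurable (fi x).
      + by apply/measurable_EFinP; exact: integrable_measurable gi.
      + by move=> y _; rewrite lee_fin; exact: fg.
  rewrite integral_cst//; apply: lte_mul_pinfty => //.
  - by apply: integral_ge0 => y _; rewrite lee_fin; exact: le_trans (fg point y).
  - exact: integrable_fin_num.
  - by apply: le_lt_trans (probability_le1 _ _) (ltry _).
have e := Fubini ig.
rewrite /Rintegral; transitivity (fine (\int[P]_x \int[Q]_y (EFin \o f) (x, y))%E).
  by congr fine; apply: eq_integral => x _; rewrite fineK//; exact: integrable_fin_num (fi x).
rewrite e; congr fine; apply: eq_integral => y _.
by rewrite fineK//; exact: integrable_fin_num (fi' y).
Qed.

End iterated_integrals.

Section independence_real.
Context {R : realType} d (T : measurableType d) (P : probability T R).
Context {N n : nat} (Y : 'I_n -> T -> rvec R N).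
Hypothesis mY : forall i, measurable_fun setT (Y i).
Hypothesis indY : mutually_independent P Y.

Lemma Rintegral_psum (j : 'I_n) (f : rvec R N * rvec R N -> R) (K : R) :
  measurable_fun setT f -> (forall w w', `|f (psum Y j w, Y j w')| <= K) ->
  \int[P]_w f (psum Y j w, Y j w) =
  \int[P]_w \int[P]_w' f (psum Y j w, Y j w').
Proof.
(* The bound on [f] is known only at values taken by the sum and the spin, so [f + K] is clipped at
   0 to be nonnegative everywhere, as [ge0_integral_psum] demands. *)
move=> mf fK; pose f' p := Num.max (f p + K) 0.
have mf' : measurable_fun setT f'.
  by apply: measurable_maxr => //; exact: measurable_funD.
have fE w w' : f (psum Y j w, Y j w') = f' (psum Y j w, Y j w') - K.
  by rewrite /f' max_l ?addrK// -lerBlDr sub0r lerNnormlW.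
have f'0 p : 0 <= f' p by rewrite /f' le_max lexx orbT.
have f'K w w' : `|f' (psum Y j w, Y j w')| <= K + K.
  by rewrite ger0_norm//; have := ler_normlW (fK w w'); rewrite fE lerBlDr.
have mp : measurable_fun setT (fun w => (psum Y j w, Y j w)).
  by apply/measurable_fun_pairP; split; [exact: measurable_psum|exact: mY].
have mpp : measurable_fun setT (fun p : T * T => (psum Y j p.1, Y j p.2)).
  apply/measurable_fun_pairP; split.
    exact: measurableT_comp (measurable_psum mY j) measurable_fst.
  exact: measurableT_comp (mY j) measurable_snd.
have i1 w : P.-integrable setT (EFin \o (fun w' => f' (psum Y j w, Y j w'))).
  apply: (@bounded_integrable _ _ _ _ _ (K + K)) => //.
  exact: measurableT_comp (measurableT_comp mf' mpp) (pair1_measurable w).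
have e : \int[P]_w f' (psum Y j w, Y j w) =
         \int[P]_w \int[P]_w' f' (psum Y j w, Y j w').
  rewrite /Rintegral (@ge0_integral_psum _ _ _ P _ _ Y mY indY j (EFin \o f')); last 2 first.
  - exact/measurable_EFinP.
  - by move=> p; rewrite /= lee_fin.
  congr fine; apply: eq_integral => w _; rewrite fineK//.
  exact: integrable_fin_num (i1 w).
transitivity (\int[P]_w (f' (psum Y j w, Y j w) - K)).
  by apply: eq_Rintegral => w _; rewrite fE.
rewrite RintegralB//; last 2 first.
- apply: (@bounded_integrable _ _ _ _ _ (K + K)) => //.
  exact: measurableT_comp mf' mp.
- exact: integrable_cst.
rewrite Rintegral_cstT e -[in LHS](Rintegral_cstT P K) -RintegralB//; last 2 first.
- apply: (@bounded_integrable _ _ _ _ _ (K + K)) => //.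
    exact: measurable_Rintegral (measurableT_comp mf' mpp).
  move=> w; rewrite (le_trans (le_normr_Rintegral _ _))//.
  rewrite -[leRHS](Rintegral_cstT P); apply: le_Rintegral => //.
    by apply: integrable_norm; exact: i1.
  exact: integrable_cst.
- exact: integrable_cst.
apply: eq_Rintegral => w _; rewrite -[in LHS](Rintegral_cstT P K) -RintegralB//; last first.
  exact: integrable_cst.
by apply: eq_Rintegral => w' _; rewrite fE.
Qed.

End independence_real.

(** * Real inequalities *)

Section exponential_inequalities.
Context {R : realType}.
Implicit Types x y z : R.

Lemma expR_sub_le x y : y <= x -> expR x - expR y <= (x - y) * expR x.
Proof.
move=> yx; have h := expR_ge1Dx (y - x).
have -> : expR y = expR (y - x) * expR x by rewrite -expRD subrK.
by have := expR_gt0 x; nra.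
Qed.

Lemma expR_sub1_le x : 0 <= x -> expR x - 1 - x <= x ^+ 2 * expR x.
Proof.
move=> x0; have h := expR_ge1Dx (- x).
have e : expR x * expR (- x) = 1 by exact: expRxMexpNx_1.
have : 0 <= (1 + x) * (expR (- x) - (1 - x)) * expR x.
  by rewrite mulr_ge0 ?expR_ge0// mulr_ge0 ?subr_ge0// addr_ge0.
rewrite (_ : _ * _ = (1 + x) * (expR x * expR (- x)) - (1 - x ^+ 2) * expR x); last by ring.
by rewrite e; lra.
Qed.

Lemma poly_le_expR (e z : R) : 0 < e -> 1 + z ^+ 2 <= (1 + e^-1) * expR (e * z ^+ 2).
Proof.
move=> e0; have h := expR_ge1Dx (e * z ^+ 2).
apply: (@le_trans _ _ ((1 + e^-1) * (1 + e * z ^+ 2))); last first.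
  by rewrite ler_wpM2l// addr_ge0// invr_ge0 ltW.
have z2 := sqr_ge0 z; have ei : 0 < e^-1 by rewrite invr_gt0.
have -> : (1 + e^-1) * (1 + e * z ^+ 2) = 1 + z ^+ 2 + e * z ^+ 2 + e^-1.
  by field; exact: lt0r_neq0.
by have := mulr_ge0 (ltW e0) z2; lra.
Qed.

Lemma absorb_factor (e a : R) : 0 < e -> exists2 C : R, 0 <= C &
  forall z, 0 <= z ->
    z * (1 + z ^+ 2) ^+ 2 * expR (1 + a * z) <= C * expR (e * z ^+ 2).
Proof.
(* Half of [e] pays for the polynomial, bounded by (1 + z^2)^3, hence the sixth in [f]; the other
   half pays for the linear exponent by completing the square. *)
move=> e0; pose f := e / 6; have f0 : 0 < f by rewrite divr_gt0.
exists ((1 + f^-1) ^+ 3 * expR (1 + a ^+ 2 / (2 * e))).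
  by rewrite mulr_ge0 ?expR_ge0// exprn_ge0// addr_ge0// invr_ge0 ltW.
move=> z z0.
have h1 := poly_le_expR z f0.
have p0 : 0 <= 1 + z ^+ 2 by rewrite addr_ge0// sqr_ge0.
have h2 : z * (1 + z ^+ 2) ^+ 2 <= (1 + f^-1) ^+ 3 * expR (e / 2 * z ^+ 2).
  apply: (@le_trans _ _ ((1 + z ^+ 2) ^+ 3)).
    rewrite (exprS _ 2) ler_wpM2r ?exprn_ge0//.
    by have := sqr_ge0 (z - 1); nra.
  have -> : expR (e / 2 * z ^+ 2) = expR (f * z ^+ 2) ^+ 3.
    by rewrite -expRM_natl; congr expR; rewrite /f; field.
  by rewrite -exprMn lerXn2r ?nnegrE// (le_trans p0).
have h3 : expR (1 + a * z) <= expR (1 + a ^+ 2 / (2 * e)) * expR (e / 2 * z ^+ 2).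
  rewrite -expRD ler_expR -addrA lerD2l -subr_ge0.
  have -> : a ^+ 2 / (2 * e) + e / 2 * z ^+ 2 - a * z = (a - e * z) ^+ 2 / (2 * e).
    by field; exact: lt0r_neq0.
  by rewrite divr_ge0 ?sqr_ge0// mulr_ge0// ltW.
have -> : expR (e * z ^+ 2) = expR (e / 2 * z ^+ 2) * expR (e / 2 * z ^+ 2).
  by rewrite -expRD; congr expR; field.
rewrite mulrACA; apply: ler_pM => //; rewrite ?expR_ge0//.
by rewrite mulr_ge0 ?exprn_ge0.
Qed.

End exponential_inequalities.

(** * Comparison of the two densities of a swap *)

Section kernel_difference.
Context {R : realType} (N : nat).
Hypothesis N0 : (0 < N)%N.

Let n1 : 1 <= N%:R :> R.
Proof. by rewrite ler1n. Qed.

(** With y = sqrt (1 + r) exp (- r / 2), the second term is y^N times the first. From exp (- r) >= 1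
    - r one gets 1 - y <= 1 - y^2 <= r^2, and Bernoulli gives 1 - y^N <= N (1 - y). *)
Let normalisation_gap (r : R) : 0 <= r -> r <= 1 ->
  0 <= (Num.sqrt (1 + r) ^+ N)^-1 - expR (- (N%:R * r / 2)) <= N%:R * r ^+ 2.
Proof.
move=> r0 r1; pose s := Num.sqrt (1 + r).
have s0 : 0 < s by rewrite sqrtr_gt0 ltr_wpDr.
have s2 : s ^+ 2 = 1 + r by rewrite sqr_sqrtr// addr_ge0.
pose y := s * expR (- (r / 2)).
have y0 : 0 < y by rewrite mulr_gt0// expR_gt0.
have y2 : y ^+ 2 = (1 + r) * expR (- r).
  by rewrite exprMn s2 -expRM_natl; congr (_ * expR _); field.
have e1 := expR_ge1Dx r; have e2 := expR_ge1Dx (- r).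
have ee : expR r * expR (- r) = 1 by exact: expRxMexpNx_1.
have ep := expR_gt0 (- r).
have y21 : y ^+ 2 <= 1 by rewrite y2; nra.
have y1 : y <= 1 by nra.
have yr : 1 - y <= r ^+ 2.
  apply: (@le_trans _ _ (1 - y ^+ 2)); first by nra.
  by rewrite y2; nra.
have -> : (s ^+ N)^-1 - expR (- (N%:R * r / 2)) = (s ^+ N)^-1 * (1 - y ^+ N).
  rewrite mulrBr mulr1; congr (_ - _).
  rewrite exprMn mulKf ?expf_neq0 ?gt_eqF// -expRM_natl; congr expR.
  by rewrite mulrN mulrA.
have yN1 : y ^+ N <= 1 by rewrite exprn_ile1// ltW.
have yN : 1 - y ^+ N <= N%:R * (1 - y).
  elim: (N) => [|k IH]; first by rewrite expr0 subrr mul0r.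
  have yk : y ^+ k <= 1 by rewrite exprn_ile1// ltW.
  rewrite exprS -natr1 mulrDl mul1r.
  have : 0 <= y ^+ k by rewrite exprn_ge0// ltW.
  by nra.
have si : (s ^+ N)^-1 <= 1.
  by rewrite invf_le1 ?exprn_gt0// exprn_ege1//; nra.
have si0 : 0 < (s ^+ N)^-1 by rewrite invr_gt0 exprn_gt0.
apply/andP; split; first by rewrite mulr_ge0 ?subr_ge0// ltW.
apply: (@le_trans _ _ (1 - y ^+ N)); first by rewrite ler_piMl// subr_ge0.
by rewrite (le_trans yN)// ler_wpM2l// (le_trans ler01).
Qed.

(** In the application [r] is 1 / m, [z] is the norm of the Gaussian vector and [M] the moment
    generating function of the spin: the first product is the density after adding a spin, the
    second the one after enlarging the variance. Writing A = r z^2 / 2, both are their constant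
    factor times 1 + A, up to O(r^2), and the constants themselves differ by O(r^2). *)
Lemma kernel_difference_le (r z M : R) : 0 < r -> r <= 1 -> 0 <= z ->
  1 + r * z ^+ 2 / 2 <= M -> M <= expR (r * z ^+ 2 / 2) -> M <= expR (N%:R * z) ->
  `|expR (- (N%:R * r / 2)) * M -
    (Num.sqrt (1 + r) ^+ N)^-1 * expR (r / (1 + r) / 2 * z ^+ 2)| <=
  2 * N%:R * r ^+ 2 * (1 + z ^+ 2) ^+ 2 *
    (expR (1 + N%:R * z) * expR (r / (1 + r) / 2 * z ^+ 2)).
Proof.
move=> r0 r1 z0 Mlo Mhi1 Mhi2.
have /andP[] := normalisation_gap (ltW r0) r1.
set c := expR (- _); set p := (_ ^+ N)^-1; move=> cp pc.
pose A := r * z ^+ 2 / 2; pose x := r / (1 + r) / 2 * z ^+ 2.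
rewrite -/A in Mlo Mhi1; rewrite -/x.
have c0 : 0 <= c by exact: expR_ge0.
have c1 : c <= 1.
  by rewrite -[leRHS]expR0 ler_expR oppr_le0 divr_ge0// mulr_ge0// ltW.
have p1 : p <= 1.
  rewrite invf_le1 ?exprn_gt0 ?sqrtr_gt0 ?ltr_wpDr ?(ltW r0)//.
  rewrite exprn_ege1// -[leLHS]sqrtr1 ler_sqrt ?lerDl ?(ltW r0)//.
  by rewrite addr_ge0// ltW.
have p0 : 0 <= p by rewrite invr_ge0 exprn_ge0// sqrtr_ge0.
have z2 : 0 <= z ^+ 2 by exact: sqr_ge0.
have rp : 0 < 1 + r by rewrite addr_gt0.
have r'0 : 0 < (1 + r)^-1 by rewrite invr_gt0.
have r'1 : (1 + r)^-1 <= 1 by rewrite invf_le1// lerDl ltW.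
have A0 : 0 <= A by rewrite /A divr_ge0// mulr_ge0// ltW.
have xE : x = A * (1 + r)^-1 by rewrite /x /A; ring.
have x0 : 0 <= x by rewrite xE mulr_ge0// ltW.
have xA : x <= A by rewrite xE ler_piMr.
have AxE : A - x = A * r * (1 + r)^-1.
  by rewrite xE; field; rewrite gt_eqF.
have Ax : A - x <= A * r by rewrite AxE ler_piMr// mulr_ge0// ltW.
pose E1 := expR (1 + N%:R * z); pose E2 := expR x.
have nz : 0 <= N%:R * z by rewrite mulr_ge0.
have E1z : expR (N%:R * z) <= E1 by rewrite ler_expR lerDr.
have E1e : expR 1 <= E1 by rewrite ler_expR lerDl.
have E11 : 1 <= E1 by rewrite -expR0 ler_expR addr_ge0.
have E21 : 1 <= E2 by rewrite -expR0 ler_expR.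
(* For A <= 1 this is Taylor expansion with exp A <= e. For A > 1 the bound exp A on [M] would not
   be integrable against the Gaussian when r = 1, so the bound exp (N z) is used, with A^2 >= 1. *)
have MA : M - 1 - A <= A ^+ 2 * E1.
  have [A1|A1] := leP A 1.
    apply: (@le_trans _ _ (expR A - 1 - A)); first by rewrite !lerD2r.
    apply: (le_trans (expR_sub1_le A0)).
    rewrite ler_wpM2l ?sqr_ge0// (le_trans _ E1e)// ler_expR//.
  apply: (@le_trans _ _ E1).
    by rewrite (le_trans _ E1z)// (le_trans _ Mhi2)// -addrA gerDl -opprD oppr_le0 addr_ge0.
  by rewrite ler_peMl ?(le_trans ler01)//; nra.
have h2 : E2 - 1 - x <= A ^+ 2 * E2.
  apply: (le_trans (expR_sub1_le x0)).
  by rewrite ler_wpM2r ?expR_ge0// lerXn2r// nnegrE.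
have E2x : 1 + x <= E2 by exact: expR_ge1Dx.
pose W := E1 * E2.
have W1 : E1 <= W by rewrite ler_peMr// (le_trans ler01).
have W2 : E2 <= W by rewrite ler_peMl// (le_trans ler01).
have W0 : 1 <= W by rewrite (le_trans E11).
have t1 : `|c * (M - 1 - A)| <= A ^+ 2 * W.
  rewrite ger0_norm; last by rewrite mulr_ge0// -addrA -opprD subr_ge0.
  apply: (@le_trans _ _ (M - 1 - A)); last by rewrite (le_trans MA)// ler_wpM2l ?sqr_ge0.
  by rewrite ler_piMl// -addrA -opprD subr_ge0.
have t2 : `|(c - p) * (1 + A)| <= N%:R * r ^+ 2 * (1 + A).
  by rewrite normrM distrC (ger0_norm cp) (ger0_norm (addr_ge0 ler01 A0)) ler_wpM2r ?addr_ge0.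
have t3 : `|p * (1 + A - E2)| <= A * r + A ^+ 2 * W.
  rewrite normrM (ger0_norm p0); apply: (@le_trans _ _ `|1 + A - E2|).
    by rewrite ler_piMl.
  have A2W : A ^+ 2 * E2 <= A ^+ 2 * W by rewrite ler_wpM2l ?sqr_ge0.
  have Ar : 0 <= A * r by rewrite mulr_ge0// ltW.
  have A20 : 0 <= A ^+ 2 * W by rewrite mulr_ge0 ?sqr_ge0// (le_trans ler01).
  by rewrite ler_norml; apply/andP; split; lra.
(* Both kernels are compared with 1 + A; the middle term collects the gap between the normalising
   constants. *)
have -> : c * M - p * expR x =
    c * (M - 1 - A) + (c - p) * (1 + A) + p * (1 + A - E2) by rewrite /E2; ring.
apply: (le_trans (ler_normD _ _)); apply: (le_trans (lerD (ler_normD _ _) (lexx _))).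
apply: (le_trans (lerD (lerD t1 t2) t3)).
rewrite -/E1 -/E2 -/W.
have q1 : A ^+ 2 <= r ^+ 2 * (z ^+ 2 * z ^+ 2) / 4 by rewrite /A le_eqVlt; apply/orP; left; apply/eqP; field.
have q2 : A * r = r ^+ 2 * z ^+ 2 / 2 by rewrite /A; ring.
have q3 : 1 + A <= 1 + z ^+ 2 / 2 by rewrite lerD2l /A ler_pM2r// ler_piMl.
set u := z ^+ 2 in z2 q1 q2 q3 *.
have r2 : 0 <= r ^+ 2 by exact: sqr_ge0.
apply: (@le_trans _ _ (r ^+ 2 * (u * u / 2 * W + N%:R * (1 + u / 2) + u / 2))).
  have a1 : A ^+ 2 * W <= r ^+ 2 * (u * u) / 4 * W.
    by rewrite ler_wpM2r// (le_trans ler01).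
  have a2 : N%:R * r ^+ 2 * (1 + A) <= N%:R * r ^+ 2 * (1 + u / 2).
    by rewrite ler_wpM2l// mulr_ge0.
  rewrite q2; lra.
rewrite [leRHS](_ : _ = r ^+ 2 * (2 * N%:R * (1 + u) ^+ 2 * W)); last by ring.
rewrite ler_wpM2l//.
have k1 : u * u / 2 * W <= N%:R * (u * u) * W.
  have uu := mulr_ge0 z2 z2; rewrite ler_wpM2r ?(le_trans ler01)//.
  by apply: (@le_trans _ _ (u * u)); [lra|rewrite ler_peMl].
have k2 : N%:R * (1 + u / 2) <= N%:R * (1 + u / 2) * W.
  by rewrite ler_peMr// mulr_ge0// addr_ge0// divr_ge0.
have k3 : u / 2 <= N%:R * u * W.
  apply: (@le_trans _ _ (N%:R * u)); last by rewrite ler_peMr// mulr_ge0.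
  by apply: (@le_trans _ _ u); [lra|rewrite ler_peMl].
have -> : 2 * N%:R * (1 + u) ^+ 2 * W =
   N%:R * (u * u) * W + N%:R * (1 + u / 2) * W + N%:R * u * W +
   (N%:R * (1 + 5 / 2 * u + u * u) * W) by field.
have : 0 <= N%:R * (1 + 5 / 2 * u + u * u) * W.
  by rewrite mulr_ge0 ?(le_trans ler01 W0)// mulr_ge0// !addr_ge0 ?mulr_ge0.
by lra.
Qed.

End kernel_difference.

(* In the case k = 0 the quotient by k is 0, which is the reason for requiring x = 0. *)
Lemma enorm_split (R : realType) (N : nat) (x y : 'rV[R]_N) (n k l : nat) :
  (k + l = n)%N -> (0 < l)%N -> (k = 0%N -> x = 0) ->
  dotp (x + y) (x + y) / n%:R <= dotp x x / k%:R + dotp y y / l%:R.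
Proof.
move=> <- l0 k0; have [kz|kp] := posnP k.
  by rewrite (k0 kz) kz add0r dotp0r mul0r add0r add0n.
have K : 0 < k%:R :> R by rewrite ltr0n.
have L : 0 < l%:R :> R by rewrite ltr0n.
rewrite natrD -subr_ge0.
(* The difference of the two sides is this square divided by k l (k + l). *)
have := dotp_ge0 (l%:R *: x - k%:R *: y).
rewrite !(dotpDl, dotpDr, dotpNl, dotpNr, dotpZl, dotpZr) (dotpC y x) => h.
rewrite (_ : _ - _ = (l%:R * (l%:R * dotp x x) - k%:R * (l%:R * dotp x y) -
   (l%:R * (k%:R * dotp x y) - k%:R * (k%:R * dotp y y))) /
   (k%:R * l%:R * (k%:R + l%:R))); last first.
  by field; rewrite !gt_eqF// addr_gt0.
apply: divr_ge0; last by rewrite !mulr_ge0 ?addr_ge0 ?(ltW K) ?(ltW L).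
by move: h; congr (is_true (0 <= _)); ring.
Qed.

Section weighted_lipschitz.
Context {R : realType} {N : nat}.

Lemma enorm_sub_le (x y : 'rV[R]_N) : `|enorm (x + y) - enorm x| <= enorm y.
Proof.
rewrite ler_norml; have h1 := enormD x y.
have := enormD (x + y) (- y); rewrite addrK -[- y]scaleN1r enormZ normrN1 mul1r.
by move=> h2; apply/andP; split; lra.
Qed.

(* [beta < b] leaves room for the polynomial factors. *)
Lemma weighted_lipschitz (beta b a K : R) : 0 <= beta -> beta < b -> 0 <= a -> 0 <= K ->
  exists2 C : R, 0 <= C &
  forall (n : nat) (f : 'rV[R]_N -> R), (0 < n)%N ->
  (forall x y : 'rV[R]_N, `|f x - f y| <= a / Num.sqrt n%:R * enorm (x - y)) -> `|f 0| <= K ->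
  let h (x : 'rV[R]_N) := f x * expR (beta / (2 * n%:R) * dotp x x) in
  (forall x, `|h x| <= C * expR (b / 2 * (dotp x x / n%:R))) /\
  forall x y, `|h (x + y) - h x| <= C / Num.sqrt n%:R * enorm y *
    (expR (b / 2 * (dotp (x + y) (x + y) / n%:R)) + expR (b / 2 * (dotp x x / n%:R))).
Proof.
(* Since beta / 2 + e = b / 2, [grow] can spend exp (e u^2) on the factor 1 + u^2. *)
move=> beta0 bb a0 K0; pose e := (b - beta) / 2.
have e0 : 0 < e by rewrite divr_gt0// subr_gt0.
pose A := (1 + beta) * (K + a); pose C := A * (1 + e^-1).
have A0 : 0 <= A by rewrite mulr_ge0 ?addr_ge0.
exists C; first by rewrite mulr_ge0// addr_ge0// invr_ge0 ltW.
move=> n f n0 flip f0 h.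
pose s := Num.sqrt n%:R : R.
have s0 : 0 < s by rewrite sqrtr_gt0 ltr0n.
have s2 : s ^+ 2 = n%:R by rewrite sqr_sqrtr.
pose rho (x : 'rV[R]_N) : R := enorm x / s.
have rho0 x : 0 <= rho x by rewrite divr_ge0 ?enorm_ge0// ltW.
have rhoE x : dotp x x / n%:R = rho x ^+ 2 by rewrite expr_div_n enorm_sqr s2.
have hE x : h x = f x * expR (beta / 2 * rho x ^+ 2).
  by rewrite -rhoE /h; congr (_ * expR _); field; rewrite pnatr_eq0 -lt0n.
have fx x : `|f x| <= K + a * rho x.
  rewrite -[f x](subrK (f 0)) (le_trans (ler_normD _ _))// addrC lerD//.
  by rewrite (le_trans (flip _ _))// subr0 /rho -/s mulrAC mulrA.
have grow (u : R) : 0 <= u -> (1 + beta) * (K + a) * (1 + u ^+ 2) * expR (beta / 2 * u ^+ 2)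
    <= C * expR (b / 2 * u ^+ 2).
  move=> u0; rewrite -/A /C -(mulrA A) -[leRHS](mulrA A) ler_wpM2l//.
  have -> : expR (b / 2 * u ^+ 2) = expR (e * u ^+ 2) * expR (beta / 2 * u ^+ 2).
    by rewrite -expRD; congr expR; rewrite /e; field.
  by rewrite mulrA ler_wpM2r ?expR_ge0// poly_le_expR.
have lin (u : R) : 0 <= u -> u <= 1 + u ^+ 2 by move=> u0; have := sqr_ge0 (u - 1); nra.
split=> [x|x y].
  rewrite hE normrM (ger0_norm (expR_ge0 _)) rhoE (le_trans _ (grow _ (rho0 x)))//.
  rewrite ler_wpM2r ?expR_ge0// (le_trans (fx x))//.
  have := lin _ (rho0 x); have := sqr_ge0 (rho x); have := rho0 x.
  move: (rho x) (rho x ^+ 2) => u v u0 v0 uv.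
  have := mulr_ge0 K0 v0; have := mulr_ge0 a0 v0.
  have : a * u <= a * (1 + v) by rewrite ler_wpM2l.
  have : 0 <= beta * ((K + a) * (1 + v)) by rewrite !mulr_ge0 ?addr_ge0.
  by lra.
pose p := rho (x + y); pose q := rho x.
have p0 : 0 <= p by exact: rho0.
have q0 : 0 <= q by exact: rho0.
have pq : `|p - q| <= enorm y / s.
  rewrite /p /q /rho -mulrBl normrM (gtr0_norm (x := s^-1)) ?invr_gt0//.
  by rewrite ler_wpM2r ?enorm_sub_le// invr_ge0 ltW.
have fxy : `|f (x + y) - f x| <= a * (enorm y / s).
  by rewrite (le_trans (flip _ _))// addrAC subrr add0r -/s mulrAC mulrA.
(* All growth is measured at the larger of the two scaled norms; its exponential is one of the two
   summands in the claim. *)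
pose r := Num.max p q.
have pr : p <= r by rewrite /r le_max lexx.
have qr : q <= r by rewrite /r le_max lexx orbT.
have r0 : 0 <= r by rewrite (le_trans p0).
pose W u : R := expR (beta / 2 * u ^+ 2).
have Wle (u v : R) : 0 <= u -> u <= v -> W u <= W v.
  move=> u0 uv; rewrite ler_expR ler_wpM2l ?divr_ge0// lerXn2r// nnegrE//.
  exact: le_trans uv.
have Wsub (u v : R) : 0 <= u -> u <= v -> v <= r -> W v - W u <= beta * r * (v - u) * W r.
  move=> u0 uv vr; apply: le_trans (expR_sub_le _) _.
    by rewrite ler_wpM2l ?divr_ge0// lerXn2r// nnegrE// (le_trans u0).
  have v0 := le_trans u0 uv.
  rewrite -mulrBr subr_sqr; apply: ler_pM; rewrite ?expR_ge0 ?Wle//.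
    by rewrite !mulr_ge0// ?subr_ge0// ?addr_ge0.
  have : (v - u) * (v + u) <= (v - u) * (2 * r) by rewrite ler_wpM2l ?subr_ge0//; lra.
  by move=> /(ler_wpM2l beta0); lra.
have WW : `|W p - W q| <= beta * r * (enorm y / s) * W r.
  have bW : 0 <= beta * r * W r by rewrite !mulr_ge0// expR_ge0.
  have [pq'|qp'] := leP p q.
    rewrite distrC ger0_norm ?subr_ge0 ?Wle//.
    apply: le_trans (Wsub _ _ p0 pq' qr) _.
    rewrite distrC ger0_norm ?subr_ge0// in pq.
    by rewrite mulrAC [leRHS]mulrAC ler_wpM2l.
  rewrite ger0_norm ?subr_ge0 ?Wle ?(ltW qp')//.
  apply: le_trans (Wsub _ _ q0 (ltW qp') pr) _.
  rewrite ger0_norm ?subr_ge0 ?(ltW qp')// in pq.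
  by rewrite mulrAC [leRHS]mulrAC ler_wpM2l.
rewrite !hE -/p -/q -/(W p) -/(W q) !rhoE -/p -/q.
have -> : f (x + y) * W p - f x * W q = (f (x + y) - f x) * W q + f (x + y) * (W p - W q).
  by ring.
have ys : 0 <= enorm y / s by rewrite divr_ge0 ?enorm_ge0// ltW.
apply: (@le_trans _ _ (enorm y / s * (C * expR (b / 2 * r ^+ 2)))).
  apply: (@le_trans _ _ (enorm y / s * ((1 + beta) * (K + a) * (1 + r ^+ 2) * W r))); last first.
    by rewrite ler_wpM2l// grow.
  apply: le_trans (ler_normD _ _) _; rewrite !normrM (ger0_norm (expR_ge0 _)).
  have t1 : `|f (x + y) - f x| * W q <= a * (enorm y / s) * W r.
    by apply: ler_pM; rewrite ?expR_ge0// Wle.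
  have t2 : `|f (x + y)| * `|W p - W q| <= (K + a * r) * (beta * r * (enorm y / s) * W r).
    apply: ler_pM => //; rewrite (le_trans (fx _))// lerD2l ler_wpM2l//.
  apply: le_trans (lerD t1 t2) _.
  rewrite [leLHS](_ : _ = enorm y / s * ((a + (K + a * r) * (beta * r)) * W r)); last by ring.
  rewrite ler_wpM2l// ler_wpM2r ?expR_ge0//.
  have := lin _ r0; have := sqr_ge0 r; rewrite expr2; set u := r * r => u0 ru.
  have -> : a + (K + a * r) * (beta * r) = a + beta * (K * r) + beta * (a * u).
    by rewrite /u; ring.
  have h1 : beta * (K * r) <= beta * (K * (1 + u)) by rewrite !ler_wpM2l.
  have h2 := mulr_ge0 beta0 a0; have h3 := mulr_ge0 K0 u0; have h4 := mulr_ge0 a0 u0.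
  by lra.
have Cs : 0 <= enorm y / s * C.
  by rewrite mulr_ge0// mulr_ge0// addr_ge0// invr_ge0 ltW.
have -> : C / s * enorm y = enorm y / s * C by ring.
rewrite (mulrA _ C) ler_wpM2l//.
by rewrite /r; case: (leP p q) => _; rewrite ?lerDr ?lerDl expR_ge0.
Qed.

End weighted_lipschitz.

(** * Replacing one spin by a Gaussian step *)

(** Unlike in [uniform_sphere_rv], norm one is demanded at every sample point, so bounds on spins
    hold without exceptional sets; the general case follows by modification on a null event. *)
Definition spherical (R : realType) d (T : measurableType d) (P : probability T R)
    (N : nat) (X : T -> rvec R N) : Prop :=
  [/\ measurable_fun setT X, forall w, dotp (X w) (X w) = 1 &
    forall O : 'M[R]_N, O *m O^T = 1%:M -> forall A : set (rvec R N), measurable A ->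
      P (X @^-1` A) = P ((fun w => (X w : 'rV[R]_N) *m O) @^-1` A)].

Section swapping.
Context {R : realType} {N : nat} (b : R).
Hypothesis N0 : (0 < N)%N.
Hypothesis bN : b < N%:R.

Let g := b / N%:R.
(** Halfway between (1 + g) / 2, the largest Gaussian exponent met in a swap, and the critical value
    1. *)
Let rho := (3 + g) / 4.

Let NR0 : 0 < N%:R :> R. Proof. by rewrite ltr0n. Qed.
Let g1 : g < 1. Proof. by rewrite ltr_pdivrMr// mul1r. Qed.
Let rho1 : rho < 1. Proof. by have := g1; rewrite /rho; lra. Qed.

(** The factor z comes from the increment of the test function, the others from the error in
    [kernel_difference_le]. *)
Let poly_exp (z : R) : R := z * (1 + z ^+ 2) ^+ 2 * expR (1 + N%:R * z).

Let poly_exp_ge0 z : 0 <= z -> 0 <= poly_exp z.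
Proof.
move=> z0; rewrite /poly_exp mulr_ge0 ?expR_ge0// mulr_ge0//.
by rewrite exprn_ge0// addr_ge0// sqr_ge0.
Qed.

Let poly_exp_ge z : 0 <= z -> z * expR (N%:R * z) <= poly_exp z.
Proof.
move=> z0; rewrite /poly_exp -mulrA ler_wpM2l// -[leLHS]mul1r.
apply: ler_pM; rewrite ?expR_ge0//; last by rewrite ler_expR lerDr.
by rewrite exprn_ege1// lerDl sqr_ge0.
Qed.

Let absorbed : exists2 C : R, 0 <= C & forall (u z : R), 0 <= z -> u <= (1 + g) / 2 ->
  poly_exp z * expR (u / 2 * z ^+ 2) <= C * expR (rho / 2 * z ^+ 2).
Proof.
(* Chosen so that (1 + g) / 4 + (1 - g) / 8 = rho / 2. *)
have e0 : 0 < (1 - g) / 8 by have := g1; lra.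
have [C C0 HC] := absorb_factor N%:R e0.
exists C => // u z z0 ug.
apply: (@le_trans _ _ (C * expR ((1 - g) / 8 * z ^+ 2) * expR (u / 2 * z ^+ 2))).
  by rewrite ler_wpM2r ?expR_ge0//; exact: HC.
rewrite -mulrA -expRD ler_wpM2l// ler_expR -mulrDl ler_wpM2r ?sqr_ge0//.
by rewrite /rho; lra.
Qed.

Section swap.
Context d (T : measurableType d) (P : probability T R) (X : T -> rvec R N).
Context d' (T' : measurableType d') (Q : probability T' R) (Z : T' -> rvec R N).
Hypothesis sX : spherical P X.
Hypothesis gZ : std_gaussian_rv Q Z.

Let mZ : measurable_fun setT Z. Proof. exact: measurable_gauss gZ. Qed.
Let mX : measurable_fun setT X. Proof. by case: sX. Qed.
Let nX w : dotp (X w) (X w) = 1. Proof. by case: sX. Qed.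
Let enX w : enorm (X w) = 1. Proof. by rewrite /enorm nX sqrtr1. Qed.

Let mF_Z F : measurable_fun setT (F : rvec R N -> R) ->
  measurable_fun setT (fun w => F (Z w)).
Proof. by move=> mF; exact: measurableT_comp mF mZ. Qed.

(* Both expectations are rewritten as integrals of [F (sqrt (m / N) *: Z)] against explicit
   densities (Cameron-Martin shift, resp. change of variance), which agree up to O(m^-2). *)
Lemma swap_step (C : R) : 0 <= C ->
  (forall (u z : R), 0 <= z -> u <= (1 + g) / 2 ->
    poly_exp z * expR (u / 2 * z ^+ 2) <= C * expR (rho / 2 * z ^+ 2)) ->
  forall (m : nat) (F : rvec R N -> R) (D : R), (0 < m)%N -> 0 <= D ->
  measurable_fun setT F ->
  (forall z : 'rV[R]_N, `|F (Num.sqrt (m%:R / N%:R) *: z)| <=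
    D * (enorm z * expR (g * (m%:R / m.+1%:R) / 2 * enorm z ^+ 2))) ->
  `|\int[P]_w \int[Q]_w' F ((X w : 'rV[R]_N) + Num.sqrt (m%:R / N%:R) *: (Z w' : 'rV[R]_N)) -
    \int[Q]_w' F (Num.sqrt (m.+1%:R / N%:R) *: (Z w' : 'rV[R]_N))| <=
  2 * N%:R * C * gauss_mass N rho * (D * m%:R ^- 2).
Proof.
move=> C0 HC m F D m0 D0 mF FD.
have M0 : 0 < m%:R :> R by rewrite ltr0n.
have M1 : 1 <= m%:R :> R by rewrite ler1n.
pose st : R := Num.sqrt (m%:R / N%:R).
have st2 : st ^+ 2 = m%:R / N%:R by rewrite sqr_sqrtr// divr_ge0// ltW.
have st0 : 0 < st by rewrite sqrtr_gt0 divr_gt0.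
pose r : R := m%:R^-1; have r0 : 0 < r by rewrite invr_gt0.
have r1 : r <= 1 by rewrite invf_le1.
have ro : r / (1 + r) = m.+1%:R^-1.
  by rewrite /r -natr1; field; rewrite !gt_eqF// ltr_wpDr.
(* Adding a spin X to st Z is shifting Z by dl X, a vector of squared length N / m. *)
pose dl : R := st^-1; have dl0 : 0 < dl by rewrite invr_gt0.
have dl2 : dl ^+ 2 = N%:R * r.
  by rewrite exprVn st2 invf_div.
have n1 : 1 <= N%:R :> R by rewrite ler1n.
have dlN : dl <= N%:R.
  rewrite -(@ler_pXn2r _ 2)// ?nnegrE ?(ltW dl0)// dl2 expr2 ler_wpM2l//.
  exact: le_trans r1 n1.
pose G (z : rvec R N) : R := F (st *: (z : 'rV[R]_N)).
have mG : measurable_fun setT G.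
  by apply: measurableT_comp mF _; exact: measurable_rvecZ.
(* The growth exponent of [F] plus the exponent 1 / (m + 1) of the enlarged Gaussian. It equals g +
   (1 - g) / (m + 1), largest at m = 1, whence (1 + g) / 2. *)
pose u := g * (m%:R / m.+1%:R) + m.+1%:R^-1.
have ug : u <= (1 + g) / 2.
  have h : m.+1%:R^-1 <= 2^-1 :> R by rewrite lef_pV2 ?posrE// ler_nat.
  have -> : u = g + (1 - g) * m.+1%:R^-1.
    by rewrite /u -natr1; field; rewrite gt_eqF// ltr_wpDr.
  have g1' : 0 <= 1 - g by rewrite subr_ge0 ltW.
  have aux (x v : R) : 0 <= 1 - x -> v <= 2^-1 -> x + (1 - x) * v <= (1 + x) / 2.
    by move=> x1 v2; have := ler_wpM2l x1 v2; lra.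
  exact: aux.
pose bd w : R := D * (C * expR (rho / 2 * dotp (Z w) (Z w))).
have ibd : Q.-integrable setT (EFin \o bd).
  apply: integrable_mulrl; apply: integrable_mulrl.
  exact: integrable_gauss_exp.
pose k (z : R) : R := poly_exp z * expR (u / 2 * z ^+ 2).
have kbd w : D * k (enorm (Z w)) <= bd w.
  by rewrite ler_wpM2l// -enorm_sqr HC// enorm_ge0.
(* Here [v] stands for any of the density factors below; every integrand of the proof is dominated
   by [bd] through this inequality. *)
have Gle (z : 'rV[R]_N) (v : R) : enorm z * v <= poly_exp (enorm z) * expR (m.+1%:R^-1 / 2 * enorm z ^+ 2) ->
    0 <= v -> `|G z| * v <= D * k (enorm z).
  move=> hv v0; apply: le_trans (ler_wpM2r v0 (FD z)) _.
  rewrite -(mulrA D) ler_wpM2l// /k.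
  have -> : u / 2 * enorm z ^+ 2 = m.+1%:R^-1 / 2 * enorm z ^+ 2 +
      g * (m%:R / m.+1%:R) / 2 * enorm z ^+ 2 by rewrite /u; ring.
  by rewrite expRD mulrA mulrAC ler_wpM2r ?expR_ge0.
have en0 (z : 'rV[R]_N) := enorm_ge0 z.
have e21 (z : 'rV[R]_N) : 1 <= expR (m.+1%:R^-1 / 2 * enorm z ^+ 2).
  by rewrite -expR0 ler_expR mulr_ge0 ?sqr_ge0// divr_ge0.
have GleN (z : 'rV[R]_N) (v : R) : 0 <= v -> v <= expR (N%:R * enorm z) ->
    `|G z| * v <= D * k (enorm z).
  move=> v0 hv; apply: Gle => //.
  apply: (@le_trans _ _ (poly_exp (enorm z))); last by rewrite ler_peMr// poly_exp_ge0.
  by rewrite (le_trans _ (poly_exp_ge _))// ler_wpM2l.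
pose c := expR (- (N%:R * r / 2)).
have c1 : c <= 1 by rewrite -[leRHS]expR0 ler_expR oppr_le0 divr_ge0// mulr_ge0// ltW.
have c0 : 0 <= c by exact: expR_ge0.
pose M (z : 'rV[R]_N) := mgf P X (dl *: z).
have enormdl (z : 'rV[R]_N) : dotp (dl *: z) (dl *: z) / (2 * N%:R) = r * enorm z ^+ 2 / 2.
  rewrite dotpZZ dl2 enorm_sqr; field; exact: lt0r_neq0.
have [mX' nX' invX'] := sX.
have Mb z : 1 + r * enorm z ^+ 2 / 2 <= M z <= expR (r * enorm z ^+ 2 / 2).
  by rewrite -enormdl; exact: (mgf_bounds N0 mX' nX' invX').
have MbN z : M z <= expR (N%:R * enorm z).
  apply: (le_trans (mgf_le_expR_enorm P mX' nX' _)); rewrite ler_expR enormZ.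
  by rewrite gtr0_norm// ler_wpM2r.
have M0' z : 0 <= M z.
  have /andP[h _] := Mb z; apply: le_trans h.
  by rewrite addr_ge0// divr_ge0// mulr_ge0 ?sqr_ge0// ltW.
pose f (p : T * T') : R := G (Z p.2) * expR (dotp (dl *: (X p.1 : 'rV[R]_N)) (Z p.2) - N%:R * r / 2).
have mXp : measurable_fun setT (fun p : T * T' => X p.1).
  exact: measurableT_comp mX measurable_fst.
have mZp : measurable_fun setT (fun p : T * T' => Z p.2).
  exact: measurableT_comp mZ measurable_snd.
have mf : measurable_fun setT f.
  apply: measurable_funM; first exact: measurableT_comp mG mZp.
  apply: measurableT_comp => //; apply: measurable_funB => //.
  by apply: measurable_dotp => //; exact: measurable_rvecZ.
have step1 : \int[P]_w \int[Q]_w' F ((X w : 'rV[R]_N) + st *: (Z w' : 'rV[R]_N)) =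
    \int[P]_w \int[Q]_w' f (w, w').
  apply: eq_Rintegral => w _.
  have := gauss_shift gZ (dl *: (X w : 'rV[R]_N)) mG.
  rewrite dotpZl dotpZr nX mulr1 -expr2 dl2 => <-.
  apply: eq_Rintegral => w' _; congr F.
  by rewrite scalerDr scalerA mulfV ?gt_eqF// scale1r addrC.
have step2 : \int[P]_w \int[Q]_w' f (w, w') = \int[Q]_w' \int[P]_w f (w, w').
  apply: (@Rintegral_Fubini _ _ _ _ _ P Q f bd mf ibd) => w w'; apply: le_trans (kbd w').
  rewrite /f /= normrM (ger0_norm (expR_ge0 _)); apply: GleN; first exact: expR_ge0.
  rewrite ler_expR; apply: (@le_trans _ _ (dotp (dl *: (X w : 'rV[R]_N)) (Z w'))).
    by rewrite gerBl divr_ge0// mulr_ge0// ltW.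
  by rewrite (le_trans (dotp_le _ _))// enormZ enX mulr1 gtr0_norm// ler_wpM2r.
have step3 w' : \int[P]_w f (w, w') = G (Z w') * (c * M (Z w')).
  rewrite /M /mgf -RintegralZl//; last exact: integrable_expR_dotp.
  rewrite -RintegralZl//; last first.
    by apply: integrable_mulrl; exact: integrable_expR_dotp.
  apply: eq_Rintegral => w _; rewrite /f /= expRD mulrC (mulrC _ (expR (- _))).
  by rewrite dotpZl dotpZl (dotpC (X w)) mulrC.
(* The ratio of the standard deviations for m + 1 and m Gaussian steps. *)
pose a := Num.sqrt (1 + r); have a0 : 0 < a by rewrite sqrtr_gt0 addr_gt0.
have a2 : a ^- 2 = (1 + r)^-1 by rewrite sqr_sqrtr// addr_ge0// ltW.
pose V (z : 'rV[R]_N) := (a ^+ N)^-1 * expR (r / (1 + r) / 2 * enorm z ^+ 2).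
have step4 : \int[Q]_w' F (Num.sqrt (m.+1%:R / N%:R) *: (Z w' : 'rV[R]_N)) =
    \int[Q]_w' (G (Z w') * V (Z w')).
  transitivity (\int[Q]_w' G (a *: (Z w' : 'rV[R]_N))).
    apply: eq_Rintegral => w' _; rewrite /G scalerA; congr F; congr (_ *: _).
    rewrite -sqrtrM ?divr_ge0 ?(ltW M0) ?(ltW NR0)//; congr Num.sqrt.
    by rewrite /r -natr1; field; rewrite !gt_eqF.
  rewrite (gauss_scale gZ a0 mG); apply: eq_Rintegral => w' _; rewrite /V.
  have -> : (1 - a ^- 2) / 2 = r / (1 + r) / 2.
    by rewrite a2; field; rewrite gt_eqF// addr_gt0.
  by rewrite enorm_sqr.
have mGZ := mF_Z mG.
have mM : measurable_fun setT (fun w' => M (Z w')).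
  apply: (@measurable_Rintegral _ _ _ _ _ P (fun p => expR (dotp (dl *: (Z p.1 : 'rV[R]_N)) (X p.2)))).
  apply: measurableT_comp => //; apply: measurable_dotp.
    by apply: measurable_rvecZ; exact: measurableT_comp mZ measurable_fst.
  exact: measurableT_comp mX measurable_snd.
have a1 : (a ^+ N)^-1 <= 1.
  rewrite invf_le1 ?exprn_gt0// exprn_ege1// -[leLHS]sqrtr1 ler_sqrt.
    by rewrite lerDl ltW.
  by rewrite addr_ge0// ltW.
have a'0 : 0 <= (a ^+ N)^-1 by rewrite invr_ge0 exprn_ge0// ltW.
have i1 : Q.-integrable setT (EFin \o (fun w' => G (Z w') * (c * M (Z w')))).
  apply: integrable_le ibd _ => [|w'].
    by apply: measurable_funM => //; exact: measurable_funM.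
  apply: le_trans (kbd w'); rewrite normrM (ger0_norm (mulr_ge0 c0 (M0' _))).
  apply: GleN; first by rewrite mulr_ge0.
  by rewrite (le_trans _ (MbN _))// ler_piMl.
have V0 z : 0 <= V z by rewrite mulr_ge0// expR_ge0.
have mV : measurable_fun setT (fun w' => V (Z w')).
  apply: measurable_funM => //; apply: measurableT_comp => //.
  by apply: measurable_funM => //; apply: measurable_funX; exact: measurable_enorm.
have i2 : Q.-integrable setT (EFin \o (fun w' => G (Z w') * V (Z w'))).
  apply: integrable_le ibd _ => [|w']; first exact: measurable_funM.
  apply: le_trans (kbd w'); rewrite normrM (ger0_norm (V0 _)).
  apply: Gle => //; rewrite /V ro; apply: ler_pM => //; first by rewrite mulr_ge0// expR_ge0.
    by rewrite (le_trans _ (poly_exp_ge _))// ler_peMr// -expR0 ler_expR mulr_ge0.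
  by rewrite ler_piMl// expR_ge0.
rewrite -/st step1 step2 (@eq_Rintegral _ _ _ Q setT (fun w' => G (Z w') * (c * M (Z w')))); last first.
  by move=> w' _; exact: step3.
rewrite step4 -RintegralB//.
have i12 := integrable_subr i1 i2.
rewrite (le_trans (le_normr_Rintegral _ i12))//.
pose K := 2 * N%:R * r ^+ 2.
have K0 : 0 <= K by rewrite /K mulr_ge0 ?sqr_ge0// mulr_ge0.
apply: (@le_trans _ _ (\int[Q]_w' (K * bd w'))).
  apply: le_Rintegral => //.
  - exact: integrable_norm.
  - exact: integrable_mulrl.
  - move=> w' _; apply: (@le_trans _ _ (K * (D * k (enorm (Z w'))))); last first.
      by rewrite ler_wpM2l.
    rewrite -mulrBr normrM.
    have /andP[Mlo Mhi] := Mb (Z w').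
    have kd := kernel_difference_le N0 r0 r1 (en0 (Z w')) Mlo Mhi (MbN _).
    apply: (@le_trans _ _ (`|G (Z w')| * (K * ((1 + enorm (Z w') ^+ 2) ^+ 2 *
      (expR (1 + N%:R * enorm (Z w')) * expR (r / (1 + r) / 2 * enorm (Z w') ^+ 2)))))).
      by rewrite ler_wpM2l// (le_trans kd)// /K -!mulrA.
    rewrite mulrCA ler_wpM2l//; apply: Gle.
      by rewrite /poly_exp ro -!mulrA.
    by rewrite mulr_ge0 ?exprn_ge0 ?addr_ge0 ?sqr_ge0// mulr_ge0 ?expR_ge0.
rewrite RintegralZl// /bd RintegralZl//; last first.
  by apply: integrable_mulrl; exact: integrable_gauss_exp.
rewrite RintegralZl//; last exact: integrable_gauss_exp.
by rewrite gauss_exp// /K /r exprVn le_eqVlt; apply/orP; left; apply/eqP; ring.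
Qed.

(** With no Gaussian step remaining there is no density comparison; the two expectations are bounded
    separately, which suffices because [D] is itself of order n^(-1/2) in the application. *)
Lemma swap_last (C : R) : 0 <= C ->
  (forall (u z : R), 0 <= z -> u <= (1 + g) / 2 ->
    poly_exp z * expR (u / 2 * z ^+ 2) <= C * expR (rho / 2 * z ^+ 2)) ->
  forall (F : rvec R N -> R) (D : R), 0 <= D -> measurable_fun setT F ->
  (forall z : 'rV[R]_N, `|F z| <= D * (enorm z * expR (b / 2 * enorm z ^+ 2))) ->
  `|\int[P]_w F (X w) - \int[Q]_w' F (Num.sqrt N%:R^-1 *: (Z w' : 'rV[R]_N))| <=
  (expR (b / 2) + C * gauss_mass N rho) * D.
Proof.
move=> C0 HC F D D0 mF FD.
have FX w : `|F (X w)| <= expR (b / 2) * D.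
  by rewrite (le_trans (FD _))// enX expr1n mulr1 mul1r mulrC.
have s2 : Num.sqrt N%:R^-1 ^+ 2 = N%:R^-1 :> R by rewrite sqr_sqrtr// invr_ge0 ltW.
have s1 : Num.sqrt N%:R^-1 <= 1 :> R.
  by rewrite -[leRHS]sqrtr1 ler_sqrt// invf_le1// ler1n.
pose bd w : R := D * (C * expR (rho / 2 * dotp (Z w) (Z w))).
have ibd : Q.-integrable setT (EFin \o bd).
  by apply: integrable_mulrl; apply: integrable_mulrl; exact: integrable_gauss_exp.
have FZ w : `|F (Num.sqrt N%:R^-1 *: (Z w : 'rV[R]_N))| <= bd w.
  apply: (le_trans (FD _)); rewrite enormZ ger0_norm ?sqrtr_ge0// exprMn s2.
  have -> : b / 2 * (N%:R^-1 * enorm (Z w) ^+ 2) = g / 2 * enorm (Z w) ^+ 2.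
    by rewrite /g; ring.
  rewrite ler_wpM2l// -enorm_sqr.
  apply: (le_trans _ (HC g _ (enorm_ge0 (Z w)) _)).
    rewrite ler_wpM2r ?expR_ge0//; apply: le_trans (poly_exp_ge (enorm_ge0 _)).
    apply: (@le_trans _ _ (1 * enorm (Z w))); first by rewrite ler_wpM2r ?enorm_ge0.
    by rewrite mul1r ler_peMr ?enorm_ge0// -expR0 ler_expR mulr_ge0 ?enorm_ge0 ?(ltW NR0).
  by have := g1; lra.
have mFZ : measurable_fun setT (fun w => F (Num.sqrt N%:R^-1 *: (Z w : 'rV[R]_N))).
  by apply: measurableT_comp mF _; exact: measurable_rvecZ.
have iX : P.-integrable setT (EFin \o (fun w => F (X w))).
  by apply: (@bounded_integrable _ _ _ _ _ (expR (b / 2) * D)) => //;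
    exact: measurableT_comp mF mX.
have iZ := integrable_le mFZ ibd FZ.
rewrite mulrDl (le_trans (ler_normB _ _))// lerD//.
  rewrite (le_trans (le_normr_Rintegral _ iX))// -[leRHS](Rintegral_cstT P).
  by apply: le_Rintegral => //; [exact: integrable_norm|exact: integrable_cst].
rewrite (le_trans (le_normr_Rintegral _ iZ))//.
apply: (@le_trans _ _ (\int[Q]_w bd w)).
  by apply: le_Rintegral => //; exact: integrable_norm.
rewrite /bd RintegralZl//; last by apply: integrable_mulrl; exact: integrable_gauss_exp.
rewrite RintegralZl//; last exact: integrable_gauss_exp.
by rewrite gauss_exp// mulrC.
Qed.

End swap.

(** Quantifying over all probability spaces inside the predicate makes [C] depend on [N] and [b]
    alone. The two clauses cover m > 0 and m = 0. *)
Definition swap_constant (C : R) : Prop :=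
  forall d (T : measurableType d) (P : probability T R) (X : T -> rvec R N)
    d' (T' : measurableType d') (Q : probability T' R) (Z : T' -> rvec R N),
  spherical P X -> std_gaussian_rv Q Z ->
  (forall (m : nat) (F : rvec R N -> R) (D : R), (0 < m)%N -> 0 <= D ->
    measurable_fun setT F ->
    (forall z : 'rV[R]_N, `|F (Num.sqrt (m%:R / N%:R) *: z)| <=
      D * (enorm z * expR (b / N%:R * (m%:R / m.+1%:R) / 2 * enorm z ^+ 2))) ->
    `|\int[P]_w \int[Q]_w' F ((X w : 'rV[R]_N) + Num.sqrt (m%:R / N%:R) *: (Z w' : 'rV[R]_N)) -
      \int[Q]_w' F (Num.sqrt (m.+1%:R / N%:R) *: (Z w' : 'rV[R]_N))| <= C * (D * m%:R ^- 2)) /\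
  (forall (F : rvec R N -> R) (D : R), 0 <= D -> measurable_fun setT F ->
    (forall z : 'rV[R]_N, `|F z| <= D * (enorm z * expR (b / 2 * enorm z ^+ 2))) ->
    `|\int[P]_w F (X w) - \int[Q]_w' F (Num.sqrt N%:R^-1 *: (Z w' : 'rV[R]_N))| <= C * D).

Lemma swap_bound : exists2 C : R, 0 <= C & swap_constant C.
Proof.
have [C C0 HC] := absorbed.
have mass0 : 0 <= gauss_mass N rho by rewrite exprn_ge0// sqrtr_ge0.
pose C1 := 2 * N%:R * C * gauss_mass N rho.
pose C2 := expR (b / 2) + C * gauss_mass N rho.
have C10 : 0 <= C1 by rewrite !mulr_ge0.
have C20 : 0 <= C2 by rewrite addr_ge0 ?expR_ge0// mulr_ge0.
exists (C1 + C2); first by rewrite addr_ge0.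
move=> d T P X d' T' Q Z sX gZ; split=> [m F D m0 D0 mF FD|F D D0 mF FD].
  apply: (le_trans (swap_step sX gZ C0 HC m0 D0 mF FD)).
  by rewrite ler_wpM2r ?lerDl// mulr_ge0// invr_ge0 exprn_ge0.
apply: (le_trans (swap_last sX gZ C0 HC D0 mF FD)).
by rewrite ler_wpM2r ?lerDr.
Qed.

End swapping.

(** * Exponential moments of the partial sums *)

Section exponential_moment.
Context {R : realType} d (T : measurableType d) (P : probability T R).
Context {N n : nat} (X : 'I_n -> T -> rvec R N).
Hypothesis N0 : (0 < N)%N.
Hypothesis sX : forall i, spherical P (X i).
Hypothesis indX : mutually_independent P X.

Let mX i : measurable_fun setT (X i). Proof. by case: (sX i). Qed.

Lemma enorm_psum_le j w : enorm (psum X j w) <= n%:R.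
Proof.
rewrite /psum big_mkcond -[n in leRHS]card_ord -sumr_const.
elim/big_rec2 : _ => [|i y u _ h]; first by rewrite /enorm dotp0r sqrtr0.
rewrite (le_trans (enormD _ _))// lerD//; case: ifP => _.
  by case: (sX i) => _ nX _; rewrite /enorm nX sqrtr1.
by rewrite /enorm dotp0r sqrtr0.
Qed.

Lemma integrable_psum_exp (a : R) j : 0 <= a ->
  P.-integrable setT (EFin \o (fun w => expR (a / 2 * dotp (psum X j w) (psum X j w)))).
Proof.
move=> a0; apply: (@bounded_integrable _ _ _ _ _ (expR (a / 2 * n%:R ^+ 2))).
  apply: measurableT_comp => //; apply: measurable_funM => //.
  by apply: measurable_dotp; exact: measurable_psum.
move=> w; rewrite ger0_norm ?expR_ge0// ler_expR -enorm_sqr ler_wpM2l ?divr_ge0//.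
by rewrite lerXn2r ?nnegrE ?enorm_ge0// enorm_psum_le.
Qed.

Lemma psum_exp_moment (j : nat) (a : R) : (j <= n)%N -> 0 <= a -> a * j%:R < N%:R ->
  \int[P]_w expR (a / 2 * dotp (psum X j w) (psum X j w)) <=
  expR (j%:R * a / (2 * (1 - a * j%:R / N%:R))).
Proof.
have NR : 0 < N%:R :> R by rewrite ltr0n.
elim: j a => [|j IH] a jn a0 aj.
  rewrite (@eq_Rintegral _ _ _ P setT (fun=> 1)); first by rewrite Rintegral_cstT !mul0r expR0.
  by move=> w _; rewrite psum0 dotp0r mulr0 expR0.
pose jo := Ordinal jn.
have aN : a < N%:R.
  by apply: le_lt_trans aj; rewrite ler_peMr// ler1n.
(* Averaging over the last spin changes [a] into at most a + a^2 / N, which [a'] dominates. The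
   choice is made because 1 / a' = 1 / a - 1 / N for positive [a]: the recursion becomes linear and
   survives j steps under a j < N. *)
pose a' := a / (1 - a / N%:R).
have q0 : 0 < 1 - a / N%:R by rewrite subr_gt0 ltr_pdivrMr// mul1r.
have a'0 : 0 <= a' by rewrite divr_ge0// ltW.
have a'E : a + a ^+ 2 / N%:R <= a'.
  rewrite ler_pdivlMr// -subr_ge0 [leRHS](_ : _ = a * (a / N%:R) ^+ 2); last first.
    by field; exact: lt0r_neq0.
  by rewrite mulr_ge0 ?sqr_ge0.
have aj' : a' * j%:R < N%:R.
  rewrite mulrAC ltr_pdivrMr//.
  have -> : N%:R * (1 - a / N%:R) = N%:R - a by field; exact: lt0r_neq0.
  by move: aj; rewrite -natr1 mulrDr mulr1 ltrBrDr.
pose f (p : rvec R N * rvec R N) : R :=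
  expR (a / 2 * dotp ((p.1 : 'rV[R]_N) + p.2) ((p.1 : 'rV[R]_N) + p.2)).
have mf : measurable_fun setT f.
  apply: measurableT_comp => //; apply: measurable_funM => //.
  by apply: measurable_dotp; apply: measurable_rvecD;
    do ?[exact: measurable_fst|exact: measurable_snd].
have fE w w' : f (psum X j w, X jo w') =
    expR (a / 2 * (dotp (psum X j w) (psum X j w) + 1)) *
    expR (dotp (a *: (psum X j w : 'rV[R]_N)) (X jo w')).
  rewrite -expRD /f /=; congr expR; rewrite !(dotpDl, dotpDr, dotpZl).
  rewrite (dotpC (X jo w')); case: (sX jo) => _ -> _; by field.
have f_le w w' : `|f (psum X j w, X jo w')| <= expR (a / 2 * (n%:R + 1) ^+ 2).
  rewrite ger0_norm ?expR_ge0// ler_expR ler_wpM2l ?divr_ge0// -enorm_sqr.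
  rewrite lerXn2r ?nnegrE ?enorm_ge0 ?addr_ge0// (le_trans (enormD _ _))// lerD//.
    exact: enorm_psum_le.
  by case: (sX jo) => _ + _ => nX; rewrite /enorm nX sqrtr1.
rewrite (@eq_Rintegral _ _ _ P setT (fun w => f (psum X j w, X jo w))); last first.
  by move=> w _; rewrite /f -(psumS X jo).
have -> : \int[P]_w f (psum X j w, X jo w) =
    \int[P]_w \int[P]_w' f (psum X j w, X jo w').
  exact: (@Rintegral_psum _ _ _ P _ _ X mX indX jo f _ mf f_le).
apply: (@le_trans _ _ (\int[P]_w (expR (a / 2) * expR (a' / 2 * dotp (psum X j w) (psum X j w))))).
  apply: le_Rintegral => //.
  - apply: (@bounded_integrable _ _ _ _ _ (expR (a / 2 * (n%:R + 1) ^+ 2))).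
      apply: (@measurable_Rintegral _ _ _ _ _ P (fun p => f (psum X j p.1, X jo p.2))).
      apply: measurableT_comp mf _; apply/measurable_fun_pairP; split.
        exact: measurableT_comp (measurable_psum mX j) measurable_fst.
      exact: measurableT_comp (mX jo) measurable_snd.
    move=> w; have iw : P.-integrable setT (EFin \o (fun w' => f (psum X j w, X jo w'))).
      apply: bounded_integrable (f_le w).
      apply: measurableT_comp mf _; apply/measurable_fun_pairP; split.
        exact: measurable_cst.
      exact: (mX jo).
    rewrite (le_trans (le_normr_Rintegral _ iw))// -[leRHS](Rintegral_cstT P).
    by apply: le_Rintegral => //; [exact: integrable_norm|exact: integrable_cst].
  - by apply: integrable_mulrl; exact: integrable_psum_exp.
  - move=> w _; case: (sX jo) => mXj nXj invXj.
    rewrite (@eq_Rintegral _ _ _ P setT (fun w' => expR (a / 2 * (dotp (psum X j w) (psum X j w) + 1)) *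
      expR (dotp (a *: (psum X j w : 'rV[R]_N)) (X jo w')))); last by move=> w' _; rewrite fE.
    rewrite RintegralZl//; last exact: integrable_expR_dotp.
    have /andP[_ h] := mgf_bounds N0 mXj nXj invXj (a *: (psum X j w : 'rV[R]_N)).
    apply: (le_trans (ler_wpM2l (expR_ge0 _) h)); rewrite -!expRD ler_expR.
    rewrite dotpZl dotpZr; set s := dotp _ _.
    rewrite [leLHS](_ : _ = a / 2 + (a + a ^+ 2 / N%:R) / 2 * s); last first.
      by field; exact: lt0r_neq0.
    by rewrite lerD2l ler_wpM2r ?dotp_ge0// ler_pM2r.
rewrite RintegralZl//; last exact: integrable_psum_exp.
apply: (le_trans (ler_wpM2l (expR_ge0 _) (IH _ (ltnW jn) a'0 aj'))).
rewrite -expRD ler_expR.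
have t0 : 0 < N%:R - a * j.+1%:R by rewrite subr_gt0.
have t1 : 0 < N%:R - a * (1 + j%:R) by move: t0; rewrite -natr1 (addrC 1).
have -> : j%:R * a' / (2 * (1 - a' * j%:R / N%:R)) = j%:R * (a * N%:R / (2 * (N%:R - a * j.+1%:R))).
  by rewrite /a' -natr1; field; rewrite !gt_eqF// subr_gt0.
have -> : j.+1%:R * a / (2 * (1 - a * j.+1%:R / N%:R)) =
    a * N%:R / (2 * (N%:R - a * j.+1%:R)) + j%:R * (a * N%:R / (2 * (N%:R - a * j.+1%:R))).
  rewrite -natr1; field.
  by rewrite (addrC j%:R) !gt_eqF.
rewrite lerD2r ler_pdivlMr ?mulr_gt0//.
have : 0 <= a * (a * j.+1%:R) by rewrite !mulr_ge0.
by lra.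
Qed.

End exponential_moment.

(** * Measurability of Lipschitz functions *)

Section lipschitz.
Context {R : realType} {N : nat}.

Lemma rational_approximation (x : 'rV[R]_N) (e : R) : 0 < e ->
  exists q : 'rV[rat]_N, enorm (x - map_mx ratr q) < e.
Proof.
move=> e0; pose h := e / N.+1%:R; have h0 : 0 < h by rewrite divr_gt0.
have /choice[q qP] : forall i : 'I_N, exists q : rat, `|x ord0 i - ratr q| < h.
  move=> i.
  have xh : x ord0 i - h < x ord0 i + h by rewrite ltrBlDr -addrA ltrDl addr_gt0.
  have [q] := rat_in_itvoo xh; rewrite in_itv/= => /andP[q1 q2].
  by exists q; rewrite ltr_norml; apply/andP; split; lra.
exists (\row_i q i).
rewrite -(@ltr_pXn2r _ 2)// ?nnegrE ?enorm_ge0 ?(ltW e0)// enorm_sqr.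
apply: (@le_lt_trans _ _ (\sum_(i < N) h ^+ 2)).
  apply: ler_sum => i _; rewrite !mxE -expr2 -(real_normK (num_real _)).
  by rewrite lerXn2r ?nnegrE ?(ltW h0)// ltW.
rewrite sumr_const card_ord -mulr_natr /h expr_div_n mulrAC ltr_pdivrMr ?exprn_gt0//.
rewrite ltr_pM2l ?exprn_gt0// -natr1 sqrrD expr1n mulr1.
have := ler0n R N; have := sqr_ge0 (N%:R : R); lra.
Qed.

(** The set f > a is the countable union over rational points q of the sets where the Lipschitz
    minorant f q - L |x - q| exceeds a, each measurable because the norm is. *)
Lemma lipschitz_measurable (f : 'rV[R]_N -> R) (L : R) : 0 <= L ->
  (forall x y : 'rV[R]_N, `|f x - f y| <= L * enorm (x - y)) ->
  measurable_fun setT (f : rvec R N -> R).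
Proof.
move=> L0 fL mT; apply: (measurability _ (RGenOInfty.measurableE R)) => // _ [_ [a ->] <-].
rewrite setTI.
pose B (q : 'rV[rat]_N) : set (rvec R N) :=
  [set x : rvec R N | a < f (map_mx ratr q) - L * enorm ((x : 'rV[R]_N) - map_mx ratr q)].
rewrite (_ : _ @^-1` _ = \bigcup_q B q).
  apply: countable_bigcupT_measurable => [|q]; first exact: countableP.
  rewrite -[B q]setTI (_ : B q = (fun x : rvec R N =>
    f (map_mx ratr q) - L * enorm ((x : 'rV[R]_N) + - map_mx ratr q)) @^-1` `]a, +oo[%classic).
    suff m : measurable_fun setT (fun x : rvec R N =>
        f (map_mx ratr q) - L * enorm ((x : 'rV[R]_N) + - map_mx ratr q)).
      by apply: m => //; exact: measurable_itv.
    apply: measurable_funB => //; apply: measurable_funM => //.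
    by apply: measurable_enorm; exact: measurable_rvecD.
  by apply/seteqP; split => x /=; rewrite in_itv/= andbT.
apply/seteqP; split => [x|x [q _]] /=; rewrite in_itv/= andbT; last first.
  rewrite /B /= => /lt_le_trans; apply.
  have := fL (map_mx ratr q) x.
  have -> : enorm (map_mx ratr q - x) = enorm ((x : 'rV[R]_N) - map_mx ratr q).
    by rewrite -[LHS]mul1r -(@normrN1 R) -enormZ scaleN1r opprB.
  by move=> /ler_normlW; lra.
move=> ax; have L1 : 0 < 2 * (L + 1) by rewrite mulr_gt0// ltr_wpDl.
have e0 : 0 < (f x - a) / (2 * (L + 1)) by rewrite divr_gt0 ?subr_gt0.
have [q qP] := rational_approximation x e0.
exists q => //; rewrite /B /=.
have h1 := ler_normlW (fL x (map_mx ratr q)).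
have h2 : 2 * (L * enorm (x - map_mx ratr q)) < f x - a.
  move: qP; rewrite (ltr_pdivlMr _ _ L1).
  move=> qE; apply: le_lt_trans qE; have := enorm_ge0 (x - map_mx ratr q).
  by move: (enorm _) => E E0; lra.
by lra.
Qed.

End lipschitz.

(** * Summability of the step costs *)

Section inverse_three_halves.
Context {R : realType}.

(** This is m^(-3/2) for m > 0, in the form sqrt m (increment) times m^-2 (densities); the value 1
    at m = 0 accounts for the last swap. *)
Definition step_weight (m : nat) : R := if m is 0 then 1 else Num.sqrt m%:R / m%:R ^+ 2.

Lemma step_weight_ge0 m : 0 <= step_weight m.
Proof. by case: m => [|m]//=; rewrite divr_ge0 ?sqrtr_ge0// exprn_ge0. Qed.

(** For the consecutive roots s, t one has t - s = 1 / (s + t), so the right side is 4 / (s t (s +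
    t)), and t (s + t) <= 4 s^2 as s >= 1. *)
Let telescoping_bound m : (0 < m)%N ->
  step_weight m <= 4 * ((Num.sqrt m%:R)^-1 - (Num.sqrt m.+1%:R)^-1).
Proof.
case: m => // m _; rewrite /step_weight.
set s := Num.sqrt m.+1%:R; set t := Num.sqrt m.+2%:R.
have s0 : 0 < s by rewrite sqrtr_gt0.
have t0 : 0 < t by rewrite sqrtr_gt0.
have s2 : m.+1%:R = s ^+ 2 :> R by rewrite sqr_sqrtr.
have t2 : t ^+ 2 = s ^+ 2 + 1 by rewrite -s2 natr1 sqr_sqrtr.
have s1 : 1 <= s by rewrite -[leLHS]sqrtr1 ler_sqrt// ler1n.
have st : s <= t by nra.
have ts : t <= 2 * s by nra.
rewrite s2 -subr_ge0 (_ : _ - _ = (4 * s ^+ 2 * (t - s) - t) / (s ^+ 3 * t)); last first.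
  by field; rewrite !gt_eqF.
rewrite divr_ge0 ?mulr_ge0 ?exprn_ge0 ?(ltW s0) ?(ltW t0)// subr_ge0.
have h : (t - s) * (t + s) = 1 by rewrite -subr_sqr t2 addrC addKr.
rewrite -(ler_pM2r (addr_gt0 t0 s0)) -[leRHS]mulrA h mulr1.
by rewrite mulrDr -expr2 t2; nra.
Qed.

Lemma step_weight_sum n : \sum_(m < n) step_weight m <= 5.
Proof.
case: n => [|n]; first by rewrite big_ord0.
(* The telescoped form is what the induction preserves; 5 is 1 for the term m = 0 plus 4 for the
   rest. *)
suff : \sum_(m < n.+1) step_weight m <= 1 + 4 * (1 - (Num.sqrt n.+1%:R)^-1).
  move=> /le_trans; apply; have : 0 <= (Num.sqrt n.+1%:R)^-1 :> R by rewrite invr_ge0 sqrtr_ge0.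
  by lra.
elim: n => [|n IH]; first by rewrite big_ord_recr big_ord0/= sqrtr1 invr1 subrr mulr0 addr0 add0r.
rewrite big_ord_recr; apply: le_trans (lerD IH (telescoping_bound (ltn0Sn n))) _.
by move: (Num.sqrt _)^-1 (Num.sqrt _)^-1 => u v; lra.
Qed.

End inverse_three_halves.

(** * Telescoping *)

Section lindeberg.
Context {R : realType} {N : nat} (b : R).
Hypothesis N0 : (0 < N)%N.
Hypothesis b0 : 0 < b.
Hypothesis bN : b < N%:R.
Context (C : R).
Hypothesis C0 : 0 <= C.
Hypothesis swapC : @swap_constant R N b C.

Let g := b / N%:R.
Let NR0 : 0 < N%:R :> R. Proof. by rewrite ltr0n. Qed.
Let g0 : 0 < g. Proof. by rewrite divr_gt0. Qed.
Let g1 : g < 1. Proof. by rewrite ltr_pdivrMr// mul1r. Qed.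

Context (n : nat).
Hypothesis n0 : (0 < n)%N.
Context d (T : measurableType d) (P : probability T R) (X : 'I_n -> T -> rvec R N).
Hypothesis sX : forall i, spherical P (X i).
Hypothesis indX : mutually_independent P X.
Context d' (T' : measurableType d') (Q : probability T' R) (Z : T' -> rvec R N).
Hypothesis gZ : std_gaussian_rv Q Z.
Context (h : rvec R N -> R) (A : R).
Hypothesis A0 : 0 <= A.
Hypothesis mh : measurable_fun setT h.
Hypothesis h_growth : forall x : 'rV[R]_N, `|h x| <= A * expR (b / 2 * (dotp x x / n%:R)).
Hypothesis h_lip : forall x y : 'rV[R]_N,
  `|h (x + y) - h x| <= A / Num.sqrt n%:R * enorm y *
    (expR (b / 2 * (dotp (x + y) (x + y) / n%:R)) + expR (b / 2 * (dotp x x / n%:R))).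

Let mX i : measurable_fun setT (X i). Proof. by case: (sX i). Qed.
Let mZ : measurable_fun setT Z. Proof. exact: measurable_gauss gZ. Qed.
Let enX i w : enorm (X i w) = 1.
Proof. by case: (sX i) => _ nX _; rewrite /enorm nX sqrtr1. Qed.

Let U (m : nat) (x : rvec R N) : R :=
  \int[Q]_w h ((x : 'rV[R]_N) + Num.sqrt (m%:R / N%:R) *: (Z w : 'rV[R]_N)).

(** The weight adapted to a sum of k terms; division by zero makes [E 0 x] equal to 1. *)
Let E (k : nat) (x : 'rV[R]_N) : R := expR (b / 2 * (dotp x x / k%:R)).

Let E_ge1 k x : 1 <= E k x.
Proof. by rewrite -expR0 ler_expR mulr_ge0 ?divr_ge0 ?dotp_ge0 ?(ltW b0). Qed.

Let b2 : 0 <= b / 2. Proof. by rewrite divr_ge0// ltW. Qed.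

Let E_split k l (x y : 'rV[R]_N) : (k + l = n)%N -> (0 < l)%N -> (k = 0%N -> x = 0) ->
  E n (x + y) <= E k x * E l y.
Proof.
move=> kl l0 k0; rewrite -expRD ler_expR -mulrDr ler_wpM2l//.
exact: enorm_split.
Qed.

Let E_mono k (x : 'rV[R]_N) : (k <= n)%N -> (k = 0%N -> x = 0) -> E n x <= E k x.
Proof.
move=> kn k0; have [kz|kp] := posnP k; first by rewrite /E (k0 kz) dotp0r !mul0r.
rewrite ler_expR ler_wpM2l// ler_wpM2l ?dotp_ge0//.
by rewrite lef_pV2 ?posrE ?ltr0n// ler_nat.
Qed.

(** After splitting the weight, the factor for m Gaussian steps of variance 1 / N has exponent g / 2
    whatever m is, so one integrable majorant serves all stages. *)
Let scaled_dominated k m (x z : 'rV[R]_N) : (k + m = n)%N -> (k = 0%N -> x = 0) ->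
  `|h (x + Num.sqrt (m%:R / N%:R) *: z)| <= A * E k x * expR (g / 2 * dotp z z).
Proof.
move=> km k0; rewrite (le_trans (h_growth _))// -(mulrA A) ler_wpM2l//.
have [mz|mp] := posnP m.
  rewrite mz mul0r sqrtr0 scale0r addr0 -[leLHS]mulr1; apply: ler_pM => //.
  - by apply: E_mono => //; rewrite -km mz addn0.
  - by rewrite -expR0 ler_expR mulr_ge0 ?dotp_ge0// divr_ge0// ltW.
apply: (le_trans (E_split _ km mp k0)); rewrite ler_wpM2l ?expR_ge0// ler_expR.
rewrite dotpZZ sqr_sqrtr ?divr_ge0// le_eqVlt; apply/orP; left; apply/eqP.
by rewrite /g; field; rewrite !gt_eqF ?ltr0n.
Qed.

Let measurable_scaled m (x : 'rV[R]_N) :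
  measurable_fun setT (fun w => h (x + Num.sqrt (m%:R / N%:R) *: (Z w : 'rV[R]_N))).
Proof.
apply: measurableT_comp mh _; apply: measurable_rvecD; first exact: measurable_cst.
exact: measurable_rvecZ.
Qed.

Let integrable_scaled k m (x : 'rV[R]_N) : (k + m = n)%N -> (k = 0%N -> x = 0) ->
  Q.-integrable setT (EFin \o (fun w => h (x + Num.sqrt (m%:R / N%:R) *: (Z w : 'rV[R]_N)))).
Proof.
move=> km k0; apply: integrable_le (measurable_scaled m x) _ _; last first.
  by move=> w; exact: scaled_dominated km k0.
by apply: integrable_mulrl; exact: integrable_gauss_exp.
Qed.

Let U_bound k m (x : 'rV[R]_N) : (k + m = n)%N -> (k = 0%N -> x = 0) ->
  `|U m x| <= A * E k x * gauss_mass N g.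
Proof.
move=> km k0; have ix := integrable_scaled km k0.
rewrite (le_trans (le_normr_Rintegral _ ix))// -(gauss_exp gZ g1).
rewrite -RintegralZl//; last exact: integrable_gauss_exp.
apply: le_Rintegral => //; first exact: integrable_norm.
  by apply: integrable_mulrl; exact: integrable_gauss_exp.
by move=> w _; exact: scaled_dominated km k0.
Qed.

Let mU m : measurable_fun setT (U m).
Proof.
apply: (@measurable_Rintegral _ _ _ _ _ Q (fun p : rvec R N * T' =>
  h ((p.1 : 'rV[R]_N) + Num.sqrt (m%:R / N%:R) *: (Z p.2 : 'rV[R]_N)))).
apply: measurableT_comp mh _; apply: measurable_rvecD; first exact: measurable_fst.
by apply: measurable_rvecZ; exact: measurableT_comp mZ measurable_snd.
Qed.

Let mass0 : 0 <= gauss_mass N g.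
Proof. by rewrite exprn_ge0// sqrtr_ge0. Qed.

Let U0 x : U 0 x = h x.
Proof.
rewrite /U (@eq_Rintegral _ _ _ Q setT (fun=> h x)) ?Rintegral_cstT// => w _.
by rewrite mul0r sqrtr0 scale0r addr0.
Qed.

Let E_bounded k (x : 'rV[R]_N) : enorm x <= n%:R -> E k x <= expR (b / 2 * n%:R ^+ 2).
Proof.
move=> xn; rewrite ler_expR ler_wpM2l// -enorm_sqr.
have xx : enorm x ^+ 2 <= n%:R ^+ 2 by rewrite lerXn2r ?nnegrE ?enorm_ge0.
case: k => [|k]; first by rewrite invr0 mulr0 exprn_ge0.
by rewrite ler_pdivrMr ?ltr0n// (le_trans xx)// ler_peMr ?exprn_ge0// ler1n.
Qed.

(** The cost of one swap given that the first k spins sum to [x]: the next spin replaces one of the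
    m + 1 remaining Gaussian steps. *)
Let step_pointwise (k : 'I_n) (x : 'rV[R]_N) : (k = 0%N :> nat -> x = 0) ->
  `|\int[P]_w U (n - k.+1) (x + X k w) - U (n - k.+1).+1 x| <=
  2 * C * A / Num.sqrt n%:R * step_weight (n - k.+1) * E k x.
Proof.
set m := (n - k.+1)%N => k0.
have km : (k + m.+1 = n)%N by rewrite /m addnS -addSn subnKC.
have km' : (k.+1 + m = n)%N by rewrite addSn -addnS.
have s0 : 0 < Num.sqrt n%:R :> R by rewrite sqrtr_gt0 ltr0n.
(* Subtracting the constant [h x] from both expectations leaves their difference unchanged and makes
   the test function vanish at 0. *)
pose F (y : rvec R N) : R := h (x + y) - h x.
have mF : measurable_fun setT F.
  apply: measurable_funB; last exact: measurable_cst.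
  by apply: measurableT_comp mh _; apply: measurable_rvecD; first exact: measurable_cst.
have FE (y : 'rV[R]_N) : `|F y| <= A / Num.sqrt n%:R * enorm y * (2 * (E k x * E m.+1 y)).
  apply: (le_trans (h_lip x y)); rewrite ler_wpM2l//.
    by rewrite mulr_ge0 ?enorm_ge0// divr_ge0// ltW.
  rewrite [leRHS]mulrDl mul1r; apply: lerD; first exact: E_split.
  rewrite -[leLHS]mulr1; apply: ler_pM => //.
  by apply: E_mono; rewrite // ltnW.
have ik w : Q.-integrable setT
    (EFin \o (fun w' => h (x + X k w + Num.sqrt (m%:R / N%:R) *: (Z w' : 'rV[R]_N)))).
  exact: (integrable_scaled km').
pose D : R := 2 * A / Num.sqrt n%:R * E k x.
have D0 : 0 <= D.
  by rewrite mulr_ge0 ?expR_ge0// divr_ge0 ?(ltW s0)// mulr_ge0.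
have lhs : \int[P]_w U m (x + X k w) - U m.+1 x =
    \int[P]_w (U m (x + X k w) - h x) -
    \int[Q]_w F (Num.sqrt (m.+1%:R / N%:R) *: (Z w : 'rV[R]_N)).
  rewrite RintegralB//; last 2 first.
  - apply: (@bounded_integrable _ _ _ _ _
      (A * expR (b / 2 * (enorm x + 1) ^+ 2) * gauss_mass N g)).
      by apply: measurableT_comp (mU m) _; apply: measurable_rvecD => //; exact: measurable_cst.
    move=> w; apply: (le_trans (U_bound km' _)) => //.
    rewrite ler_wpM2r// ler_wpM2l// ler_expR ler_wpM2l// -enorm_sqr.
    rewrite ler_pdivrMr ?ltr0n// -[leLHS]mulr1; apply: ler_pM; rewrite ?sqr_ge0 ?ler1n//.
    rewrite lerXn2r ?nnegrE ?enorm_ge0 ?addr_ge0 ?enorm_ge0// (le_trans (enormD _ _))//.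
    by rewrite enX.
  - exact: integrable_cst.
  rewrite Rintegral_cstT [X in _ = _ - X]RintegralB//; last 2 first.
  - exact: (integrable_scaled km k0).
  - exact: integrable_cst.
  by rewrite Rintegral_cstT -/(U m.+1 x); ring.
rewrite lhs.
have -> : 2 * C * A / Num.sqrt n%:R * step_weight m * E k x = C * (D * step_weight m).
  by rewrite /D; ring.
(* The case m = 0 is the swap of the final spin, the second clause of [swapC]. *)
have [mz|mp] := posnP m.
  rewrite mz /= mulr1.
  have -> : \int[P]_w (U 0 (x + X k w) - h x) = \int[P]_w F (X k w).
    by apply: eq_Rintegral => w _; rewrite U0.
  have -> : 1%:R / N%:R = N%:R^-1 :> R by rewrite div1r.
  have [_] := swapC (sX k) gZ; apply => // z.
  apply: (le_trans (FE z)); rewrite /D mz /E enorm_sqr divr1.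
  by rewrite le_eqVlt; apply/orP; left; apply/eqP; ring.
have -> : \int[P]_w (U m (x + X k w) - h x) =
    \int[P]_w \int[Q]_w' F ((X k w : 'rV[R]_N) + Num.sqrt (m%:R / N%:R) *: (Z w' : 'rV[R]_N)).
  apply: eq_Rintegral => w _; rewrite RintegralB//; last exact: integrable_cst; last first.
    by under eq_fun do rewrite addrA; exact: ik.
  rewrite Rintegral_cstT /U; congr (_ - _).
  by apply: eq_Rintegral => w' _; rewrite addrA.
have sm0 : 0 < m%:R :> R by rewrite ltr0n.
have -> : C * (D * step_weight m) = C * (D * Num.sqrt m%:R * m%:R ^- 2).
  by case: (m) mp => // m' _; rewrite /= !mulrA.
have [+ _] := swapC (sX k) gZ; apply => //; first by rewrite mulr_ge0 ?sqrtr_ge0.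
move=> z; apply: (le_trans (FE _)).
have st : Num.sqrt (m%:R / N%:R) <= Num.sqrt m%:R :> R.
  by rewrite ler_sqrt// ler_piMr ?(ltW sm0)// invf_le1// ler1n.
rewrite enormZ ger0_norm ?sqrtr_ge0//.
(* The argument has the scale of m Gaussian steps, the weight that of m + 1. The resulting ratio m /
   (m + 1) is what leaves room for the exponent 1 / (m + 1) in [swap_step]. *)
have -> : E m.+1 (Num.sqrt (m%:R / N%:R) *: z) =
    expR (b / N%:R * (m%:R / m.+1%:R) / 2 * enorm z ^+ 2).
  rewrite /E dotpZZ sqr_sqrtr ?divr_ge0// enorm_sqr; congr expR.
  by field; rewrite !gt_eqF ?ltr0n.
set e := expR _; have e0 : 0 <= e by exact: expR_ge0.
rewrite [leLHS](_ : _ = D * Num.sqrt (m%:R / N%:R) * (enorm z * e)); last by rewrite /D; ring.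
by rewrite ler_wpM2r ?mulr_ge0 ?enorm_ge0// ler_wpM2l.
Qed.

Let moment := expR (b / (2 * (1 - g))).

(** In [psum_exp_moment] one takes a = b / k, so that a k = b and the bound is the same for every k
    > 0; for k = 0 the weight is 1. *)
Let psum_E_moment k : (k <= n)%N -> \int[P]_w E k (psum X k w) <= moment.
Proof.
move=> kn; have gp : 0 < 1 - g by rewrite subr_gt0.
case: k kn => [_|k kn].
  rewrite (@eq_Rintegral _ _ _ P setT (fun=> 1)); last first.
    by move=> w _; rewrite /E psum0 dotp0r mul0r mulr0 expR0.
  rewrite Rintegral_cstT -expR0 ler_expR divr_ge0 ?mulr_ge0 ?(ltW b0) ?(ltW gp)//.
have K0 : 0 < k.+1%:R :> R by rewrite ltr0n.
have e : b / k.+1%:R * k.+1%:R = b by rewrite divfK// gt_eqF.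
have h1 : 0 <= b / k.+1%:R by rewrite divr_ge0// ltW.
have h2 : b / k.+1%:R * k.+1%:R < N%:R by rewrite e.
have := psum_exp_moment N0 sX indX kn h1 h2; rewrite (mulrC k.+1%:R) !e -/g -/moment.
apply: le_trans; rewrite le_eqVlt; apply/orP; left; apply/eqP.
apply: eq_Rintegral => w _; rewrite /E; congr expR; field; exact: lt0r_neq0.
Qed.

Let integrable_psum_E k : P.-integrable setT (EFin \o (fun w => E k (psum X k w))).
Proof.
apply: (@bounded_integrable _ _ _ _ _ (expR (b / 2 * n%:R ^+ 2))).
  rewrite /E; apply: measurableT_comp => //.
  apply: measurable_funM => //; apply: measurable_funM => //.
  by apply: measurable_dotp; exact: measurable_psum.
move=> w; rewrite ger0_norm ?expR_ge0//; apply: E_bounded.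
exact: (enorm_psum_le sX).
Qed.

Let integrable_U_psum k m : (k + m = n)%N ->
  P.-integrable setT (EFin \o (fun w => U m (psum X k w))).
Proof.
move=> km; apply: (@bounded_integrable _ _ _ _ _
  (A * expR (b / 2 * n%:R ^+ 2) * gauss_mass N g)).
  exact: measurableT_comp (mU m) (measurable_psum mX k).
move=> w; apply: (le_trans (U_bound km _)); first by move=> ->; rewrite psum0.
rewrite ler_wpM2r// ler_wpM2l//; apply: E_bounded; exact: (enorm_psum_le sX).
Qed.

Let step (k : 'I_n) :
  `|\int[P]_w U (n - k.+1) (psum X k.+1 w) - \int[P]_w U (n - k) (psum X k w)| <=
  2 * C * A / Num.sqrt n%:R * step_weight (n - k.+1) * moment.
Proof.
have km : (k.+1 + (n - k.+1) = n)%N by rewrite subnKC.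
have nk : (n - k = (n - k.+1).+1)%N by rewrite subnSK.
have km' : (k + (n - k) = n)%N by rewrite subnKC// ltnW.
have pk w : k = 0%N :> nat -> psum X k w = 0 :> 'rV[R]_N by move=> ->; rewrite psum0.
set m := (n - k.+1)%N in km nk *.
pose f (p : rvec R N * rvec R N) : R := U m ((p.1 : 'rV[R]_N) + p.2).
have mf : measurable_fun setT f.
  by apply: measurableT_comp (mU m) _; apply: measurable_rvecD;
    [exact: measurable_fst|exact: measurable_snd].
pose B := A * expR (b / 2 * (n%:R + 1) ^+ 2) * gauss_mass N g.
have fB w w' : `|f (psum X k w, X k w')| <= B.
  apply: (le_trans (U_bound km _)) => //.
  rewrite ler_wpM2r// ler_wpM2l// ler_expR ler_wpM2l// -enorm_sqr.
  rewrite ler_pdivrMr ?ltr0n// -[leLHS]mulr1; apply: ler_pM; rewrite ?sqr_ge0 ?ler1n//.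
  rewrite lerXn2r ?nnegrE ?enorm_ge0 ?addr_ge0// (le_trans (enormD _ _))//.
  by rewrite enX lerD2r; exact: (enorm_psum_le sX).
have -> : \int[P]_w U m (psum X k.+1 w) = \int[P]_w \int[P]_w' f (psum X k w, X k w').
  rewrite -(@Rintegral_psum _ _ _ P _ _ X mX indX k f B mf fB).
  by apply: eq_Rintegral => w _; rewrite /f (psumS X k).
have mfw w : measurable_fun setT (fun w' => f (psum X k w, X k w')).
  by apply: measurableT_comp (mU m) _; apply: measurable_rvecD;
    [exact: measurable_cst|exact: (mX k)].
have ifw w : P.-integrable setT (EFin \o (fun w' => f (psum X k w, X k w'))).
  by apply: bounded_integrable (fB w).
have i1 : P.-integrable setT (EFin \o (fun w => \int[P]_w' f (psum X k w, X k w'))).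
  apply: (@bounded_integrable _ _ _ _ _ B).
    apply: (@measurable_Rintegral _ _ _ _ _ P (fun p => f (psum X k p.1, X k p.2))).
    apply: measurableT_comp mf _; apply/measurable_fun_pairP; split.
      exact: measurableT_comp (measurable_psum mX k) measurable_fst.
    exact: measurableT_comp (mX k) measurable_snd.
  move=> w; rewrite (le_trans (le_normr_Rintegral _ (ifw w)))// -[leRHS](Rintegral_cstT P).
  by apply: le_Rintegral => //; [exact: integrable_norm|exact: integrable_cst].
have i2 := integrable_U_psum km'.
rewrite -RintegralB//.
rewrite (le_trans (le_normr_Rintegral _ (integrable_subr i1 i2)))//.
set c := 2 * C * A / _ * _.
have c0 : 0 <= c.
  by rewrite mulr_ge0 ?step_weight_ge0// divr_ge0 ?sqrtr_ge0// !mulr_ge0.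
apply: (@le_trans _ _ (\int[P]_w (c * E k (psum X k w)))).
  apply: le_Rintegral => //.
  - exact: integrable_norm (integrable_subr i1 i2).
  - exact: integrable_mulrl.
  - by move=> w _; rewrite nk; exact: step_pointwise (pk w).
rewrite RintegralZl// ler_wpM2l//; apply: psum_E_moment.
exact: ltnW.
Qed.

Lemma lindeberg_comparison :
  `|\int[P]_w h (\sum_(i < n) (X i w : 'rV[R]_N)) -
    \int[Q]_w h (Num.sqrt (n%:R / N%:R) *: (Z w : 'rV[R]_N))| <=
  10 * C * moment * A / Num.sqrt n%:R.
Proof.
pose a k := \int[P]_w U (n - k) (psum X k w).
have -> : \int[P]_w h (\sum_(i < n) (X i w : 'rV[R]_N)) = a n.
  by rewrite /a subnn; apply: eq_Rintegral => w _; rewrite U0 -(psum_all X).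
have -> : \int[Q]_w h (Num.sqrt (n%:R / N%:R) *: (Z w : 'rV[R]_N)) = a 0.
  rewrite /a subn0 (@eq_Rintegral _ _ _ P setT (fun=> U n 0)) ?Rintegral_cstT.
    by apply: eq_Rintegral => w _; rewrite add0r.
  by move=> w _; rewrite psum0.
have -> : a n - a 0 = \sum_(k < n) (a k.+1 - a k).
  by rewrite -(big_mkord xpredT (fun k => a k.+1 - a k)) telescope_sumr.
apply: (le_trans (ler_norm_sum _ _ _)).
pose c := 2 * C * A / Num.sqrt n%:R * moment.
have c0 : 0 <= c by rewrite mulr_ge0 ?expR_ge0// divr_ge0 ?sqrtr_ge0// !mulr_ge0.
apply: (@le_trans _ _ (\sum_(k < n) c * step_weight (n - k.+1))).
  by apply: ler_sum => k _; rewrite /a (le_trans (step k))// /c le_eqVlt; apply/orP; left; apply/eqP; ring.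
(* Counting the Gaussian steps left instead of the spins placed turns the weights into those of
   [step_weight_sum]; its 5 and the 2 in [c] make the 10. *)
rewrite -mulr_sumr (reindex_inj rev_ord_inj)/=.
rewrite (eq_bigr (fun k : 'I_n => step_weight k)); last first.
  by move=> k _; rewrite subnSK// subKn// ltnW.
apply: (le_trans (ler_wpM2l c0 (step_weight_sum n))).
by rewrite /c le_eqVlt; apply/orP; left; apply/eqP; ring.
Qed.

End lindeberg.

(** * Passage to the Gibbs measure *)

Section gibbs_spherical.
Context {R : realType} {N : nat} (beta : R).
Hypothesis N0 : (0 < N)%N.
Hypothesis beta0 : 0 <= beta.
Hypothesis betaN : beta < N%:R.

Let NR0 : 0 < N%:R :> R. Proof. by rewrite ltr0n. Qed.

Lemma gibbs_weightE n (s : 'I_n -> 'rV[R]_N) :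
  gibbs_weight beta s = expR (beta / (2 * n%:R) * dotp (\sum_i s i) (\sum_i s i)).
Proof.
rewrite /gibbs_weight; congr (expR (_ * _)).
rewrite dotp_sumr exchange_big/=; apply: eq_bigr => j _.
by rewrite dotpC dotp_sumr; apply: eq_bigr => i _; rewrite dotpC.
Qed.

(** Uses |z| <= 2 exp (|z|^2 / 4). The bound is the same for every [g], which keeps the final
    constant uniform although [g 0] is arbitrary. *)
Lemma lipschitz_gauss_mean d (T : measurableType d) (Q : probability T R) (Z : T -> rvec R N)
    (g : 'rV[R]_N -> R) : std_gaussian_rv Q Z -> lipschitz_le1 g ->
  Q.-integrable setT (EFin \o (fun w => g (Z w))) /\
  `|g 0 - \int[Q]_w g (Z w)| <= 2 * gauss_mass N 2^-1.
Proof.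
move=> gZ gL; have mZ := measurable_gauss gZ.
have mg : measurable_fun setT (g : rvec R N -> R).
  by apply: (@lipschitz_measurable _ _ g 1) => // x y; rewrite mul1r; exact: gL.
have mgZ : measurable_fun setT (fun w => g (Z w)) by exact: measurableT_comp mg mZ.
have h1 : 2^-1 < 1 :> R by rewrite invf_lt1// ltr1n.
pose e w : R := 2 * expR (2^-1 / 2 * dotp (Z w) (Z w)).
have ie : Q.-integrable setT (EFin \o e).
  by apply: integrable_mulrl; exact: integrable_gauss_exp.
have le w : `|g 0 - g (Z w)| <= e w.
  rewrite (le_trans (gL _ _))// sub0r -scaleN1r enormZ normrN1 mul1r.
  have := expR_ge1Dx (2^-1 / 2 * dotp (Z w) (Z w)); rewrite /e -enorm_sqr.
  by have := sqr_ge0 (enorm (Z w) - 1); rewrite sqrrB1; lra.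
have i0 : Q.-integrable setT (EFin \o (fun w => g 0 - g (Z w))).
  apply: integrable_le ie le.
  by apply: measurable_funB => //; exact: measurable_cst.
have ig : Q.-integrable setT (EFin \o (fun w => g (Z w))).
  have := integrable_subr (integrable_cst Q (g 0)) i0.
  by apply: eq_integrable => // w _ /=; rewrite opprB addrCA subrr addr0.
split=> //; have -> : g 0 - \int[Q]_w g (Z w) = \int[Q]_w (g 0 - g (Z w)).
  by rewrite RintegralB// ?Rintegral_cstT//; exact: integrable_cst.
rewrite (le_trans (le_normr_Rintegral _ i0))//.
apply: (@le_trans _ _ (\int[Q]_w e w)).
  by apply: le_Rintegral => //; exact: integrable_norm.
by rewrite /e RintegralZl// ?(gauss_exp gZ)//; exact: integrable_gauss_exp.
Qed.

Lemma gibbs_spherical : exists c : R, forall n : nat, (0 < n)%N ->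
  forall d (T : measurableType d) (P : probability T R) (X : 'I_n -> T -> rvec R N)
    d' (T' : measurableType d') (Q : probability T' R) (Z : T' -> rvec R N) g,
  (forall i, spherical P (X i)) -> mutually_independent P X ->
  std_gaussian_rv Q Z -> lipschitz_le1 g ->
  `|gibbs_expect P beta X (fun s => g (Wn beta s)) - expect Q (fun w => g (Z w))|
    <= c / Num.sqrt n%:R.
Proof.
pose b := (beta + N%:R) / 2.
have [bb bN] : beta < b /\ b < N%:R by have [] := midf_lt betaN.
have b0 : 0 < b by rewrite (le_lt_trans beta0).
have b2 : 0 <= b / 2 by exact: mulr_ge0 (ltW b0) _.
have [C C0 swapC] := swap_bound N0 bN.
pose a := Num.sqrt (N%:R - beta).
pose K : R := 2 * gauss_mass N 2^-1.
have K0 : 0 <= K by rewrite mulr_ge0// exprn_ge0// sqrtr_ge0.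
have [A A0 HA] := @weighted_lipschitz R N beta b a K beta0 bb (sqrtr_ge0 _) K0.
exists (10 * C * expR (b / (2 * (1 - b / N%:R))) * A).
move=> n n0 d T P X d' T' Q Z g sX indX gZ gL.
have nR0 : 0 < n%:R :> R by rewrite ltr0n.
have [iG GK] := lipschitz_gauss_mean gZ gL.
rewrite /gibbs_expect; set G := expect Q _.
pose sc : R := Num.sqrt ((N%:R - beta) / n%:R).
have scE : sc = a / Num.sqrt n%:R.
  by rewrite /sc /a sqrtrM ?subr_ge0 ?(ltW betaN)// sqrtrV// ltW.
(* Centring at the Gaussian mean bounds [f 0] independently of [g] and makes the Gaussian end of the
   telescope vanish. *)
pose f (x : 'rV[R]_N) : R := g (sc *: x) - G.
have fL (x y : 'rV[R]_N) : `|f x - f y| <= a / Num.sqrt n%:R * enorm (x - y).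
  rewrite /f opprB addrA subrK (le_trans (gL _ _))// -scalerBr enormZ -scE.
  by rewrite ger0_norm// sqrtr_ge0.
have f0 : `|f 0| <= K by rewrite /f scaler0.
have [h_growth h_lip] := HA n f n0 fL f0.
pose h : rvec R N -> R := fun x => f x * expR (beta / (2 * n%:R) * dotp x x).
have mexp : measurable_fun setT (fun x : rvec R N => expR (beta / (2 * n%:R) * dotp x x)).
  apply: measurableT_comp => //; apply: measurable_funM => //.
  by apply: measurable_dotp; exact: measurable_id.
have mf : measurable_fun setT (f : rvec R N -> R).
  apply: lipschitz_measurable fL.
  by rewrite divr_ge0 ?sqrtr_ge0.
have mh : measurable_fun setT h by exact: measurable_funM.
have := lindeberg_comparison N0 b0 bN C0 swapC n0 sX indX gZ A0 mh h_growth h_lip.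
have -> : \int[Q]_w h (Num.sqrt (n%:R / N%:R) *: (Z w : 'rV[R]_N)) = 0.
  (* The Gibbs factor tilts a Gaussian of variance n / N into a multiple of one of variance n / (N -
     beta), which [sc] normalises to 1; [l] is the ratio of the standard deviations. *)
  pose l := Num.sqrt (N%:R / (N%:R - beta)).
  have l0 : 0 < l by rewrite sqrtr_gt0 divr_gt0// subr_gt0.
  have l2 : l ^- 2 = (N%:R - beta) / N%:R.
    by rewrite sqr_sqrtr ?invf_div// divr_ge0 ?(ltW NR0)// subr_ge0 ltW.
  pose F (x : rvec R N) : R := g (l^-1 *: (x : 'rV[R]_N)) - G.
  have mg : measurable_fun setT (g : rvec R N -> R).
    by apply: (@lipschitz_measurable _ _ g 1) => // x y; rewrite mul1r; exact: gL.
  have mF : measurable_fun setT F.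
    apply: measurable_funB; last exact: measurable_cst.
    by apply: measurableT_comp mg _; apply: measurable_rvecZ; exact: measurable_id.
  have := gauss_scale gZ l0 mF.
  have -> : \int[Q]_w F (l *: (Z w : 'rV[R]_N)) = 0.
    transitivity (\int[Q]_w (g (Z w) - G)).
      by apply: eq_Rintegral => w _; rewrite /F scalerA mulVf ?gt_eqF// scale1r.
    by rewrite RintegralB// ?Rintegral_cstT ?subrr//; exact: integrable_cst.
  have hZ w : F (Z w) * ((l ^+ N)^-1 * expR ((1 - l ^- 2) / 2 * dotp (Z w) (Z w))) =
      (l ^+ N)^-1 * h (Num.sqrt (n%:R / N%:R) *: (Z w : 'rV[R]_N)).
    rewrite /h /F /f scalerA.
    have -> : sc * Num.sqrt (n%:R / N%:R) = l^-1.
      rewrite /sc -sqrtrM ?divr_ge0 ?subr_ge0 ?(ltW betaN) ?(ltW nR0)// /l.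
      rewrite -sqrtrV ?divr_ge0 ?subr_ge0 ?(ltW betaN) ?(ltW NR0)//; congr Num.sqrt.
      by rewrite invf_div; field; rewrite !gt_eqF.
    rewrite l2 dotpZZ sqr_sqrtr ?divr_ge0 ?(ltW NR0) ?(ltW nR0)//.
    have -> : beta / (2 * n%:R) * (n%:R / N%:R * dotp (Z w) (Z w)) =
        (1 - (N%:R - beta) / N%:R) / 2 * dotp (Z w) (Z w).
      by field; rewrite !gt_eqF.
    by rewrite mulrCA mulrA.
  have ih : Q.-integrable setT
      (EFin \o (fun w => h (Num.sqrt (n%:R / N%:R) *: (Z w : 'rV[R]_N)))).
    apply: (@integrable_le _ _ _ _ _ (fun w => A * expR (b / N%:R / 2 * dotp (Z w) (Z w)))).
    - by apply: measurableT_comp mh _; apply: measurable_rvecZ; exact: measurable_gauss gZ.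
    - apply: integrable_mulrl; apply: (integrable_gauss_exp gZ).
      by rewrite ltr_pdivrMr// mul1r.
    - move=> w; rewrite (le_trans (h_growth _))// dotpZZ sqr_sqrtr ?divr_ge0//.
      by rewrite le_eqVlt; apply/orP; left; apply/eqP; congr (_ * expR _); field; rewrite !gt_eqF.
  rewrite (@eq_Rintegral _ _ _ Q setT
    (fun w => (l ^+ N)^-1 * h (Num.sqrt (n%:R / N%:R) *: (Z w : 'rV[R]_N)))); last first.
    by move=> w _; exact: hZ.
  rewrite RintegralZl// => /esym/eqP; rewrite mulf_eq0 invr_eq0 expf_eq0 (gt_eqF l0) andbF.
  by move=> /eqP.
rewrite subr0; apply: le_trans.
pose wt w := gibbs_weight beta (fun i => X i w : 'rV[R]_N).
have wtE w : wt w = expR (beta / (2 * n%:R) *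
    dotp (\sum_i (X i w : 'rV[R]_N)) (\sum_i (X i w : 'rV[R]_N))) by exact: gibbs_weightE.
have mX i : measurable_fun setT (X i) by case: (sX i).
have mS : measurable_fun setT (fun w => (\sum_i (X i w : 'rV[R]_N)) : rvec R N).
  exact: measurable_rvec_sum.
have Sn w : enorm (\sum_i (X i w : 'rV[R]_N)) <= n%:R.
  by rewrite -(psum_all X); exact: (enorm_psum_le sX).
have iwt : P.-integrable setT (EFin \o wt).
  apply: (@bounded_integrable _ _ _ _ _ (expR (beta / (2 * n%:R) * n%:R ^+ 2))).
    by rewrite (_ : wt = (fun x : rvec R N => expR (beta / (2 * n%:R) * dotp x x)) \o
      (fun w => (\sum_i (X i w : 'rV[R]_N)) : rvec R N)) //;
      [exact: measurableT_comp mexp mS|apply/funext => w; exact: wtE].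
  move=> w; rewrite wtE ger0_norm ?expR_ge0// ler_expR ler_wpM2l ?divr_ge0// -enorm_sqr.
  by rewrite lerXn2r ?nnegrE ?enorm_ge0.
have ihS : P.-integrable setT (EFin \o (fun w => h (\sum_i (X i w : 'rV[R]_N)))).
  apply: (@bounded_integrable _ _ _ _ _ (A * expR (b / 2 * (n%:R ^+ 2 / n%:R)))).
    exact: measurableT_comp mh mS.
  move=> w; rewrite (le_trans (h_growth _))// ler_wpM2l// ler_expR (ler_wpM2l b2)//.
  by rewrite ler_pM2r ?invr_gt0// -enorm_sqr lerXn2r ?nnegrE ?enorm_ge0.
(* Integrated and divided by the partition function [B], this exhibits the error as the integral of
   [h] over [B]. *)
have hE w : g (Wn beta (fun i => X i w : 'rV[R]_N)) * wt w =
    h (\sum_i (X i w : 'rV[R]_N)) + G * wt w.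
  by rewrite /h -wtE /f /Wn -/sc; ring.
pose B := expect P wt.
have B1 : 1 <= B.
  rewrite -[leLHS](Rintegral_cstT P); apply: le_Rintegral => //; first exact: integrable_cst.
  by move=> w _; rewrite wtE -expR0 ler_expR mulr_ge0 ?divr_ge0 ?mulr_ge0 ?dotp_ge0.
have -> : expect P (fun w => g (Wn beta (fun i => X i w : 'rV[R]_N)) * wt w) =
    \int[P]_w h (\sum_i (X i w : 'rV[R]_N)) + G * B.
  transitivity (\int[P]_w (h (\sum_i (X i w : 'rV[R]_N)) + G * wt w)).
    by apply: eq_Rintegral => w _; exact: hE.
  rewrite RintegralD//; last exact: integrable_mulrl.
  by rewrite RintegralZl.
have B0 : 0 < B by rewrite (lt_le_trans _ B1).
rewrite -/wt -/B mulrDl mulfK ?gt_eqF// addrK normrM.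
by rewrite ler_piMr// ger0_norm ?invr_ge0 ?(ltW B0)// invf_le1.
Qed.

End gibbs_spherical.

(** * Reduction to spins of norm exactly one *)

Section full_sets.
Context {R : realType} d (T : measurableType d) (P : probability T R) (S : set T).
Hypothesis mS : measurable S.
Hypothesis PS : P S = 1%E.

Let PCS : P (~` S) = 0%E.
Proof. by rewrite probability_setC// PS subee. Qed.

Lemma probability_eq_full (A B : set T) : measurable A -> measurable B ->
  (forall w, S w -> A w <-> B w) -> P A = P B.
Proof.
move=> mA mB AB.
have full (C : set T) : measurable C -> P C = P (C `&` S).
  move=> mC; rewrite (measureDI P mC mS) [X in (X + _)%E](_ : _ = 0%E) ?add0e//.
  apply/eqP; rewrite eq_le measure_ge0 andbT -PCS.
  apply: le_measure; last by move=> w [].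
    by rewrite inE; exact: measurableD.
  by rewrite inE; exact: measurableC.
rewrite (full A)// (full B)//; congr (P _).
by apply/seteqP; split => w [Cw Sw]; split => //; apply/(AB w Sw).
Qed.

Lemma Rintegral_eq_full (f g : T -> R) : measurable_fun setT f -> measurable_fun setT g ->
  (forall w, S w -> f w = g w) -> \int[P]_w f w = \int[P]_w g w.
Proof.
move=> mf mg fg; congr fine; apply: ae_eq_integral => //.
- exact/measurable_EFinP.
- exact/measurable_EFinP.
- exists (~` S); split => //; first exact: measurableC.
  by move=> w /= nfg Sw; apply: nfg => _; rewrite fg.
Qed.

End full_sets.

Section spherical_version.
Context {R : realType} d (T : measurableType d) (P : probability T R).
Context {N : nat} (i0 : 'I_N).
Implicit Types X : T -> rvec R N.

(** Off the sphere, an event of probability zero for a uniform spin, a fixed unit vector is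
    substituted; this gives norm one everywhere without changing the law. *)
Definition normalised X (w : T) : rvec R N :=
  if dotp (X w) (X w) == 1 then X w else unit_vec i0.

Lemma measurable_normalised X : measurable_fun setT X -> measurable_fun setT (normalised X).
Proof.
move=> mX; apply: measurable_fun_ifT => //.
by apply: measurable_fun_eqr => //; exact: measurable_dotp.
Qed.

Lemma dotp_normalised X w : dotp (normalised X w) (normalised X w) = 1.
Proof.
rewrite /normalised; case: eqP => // _.
rewrite /dotp (bigD1 i0)//= !mxE !eqxx mulr1 big1 ?addr0// => i ii.
by rewrite !mxE eqxx/= (negPf ii) mul0r.
Qed.

Definition on_sphere X : set T := [set w | dotp (X w) (X w) = 1].

Lemma measurable_on_sphere X : measurable_fun setT X -> measurable (on_sphere X).
Proof.
move=> mX; rewrite -[on_sphere X]setTI.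
by have := measurable_dotp mX mX measurableT (measurable_set1 (1 : R)); apply.
Qed.

Lemma normalisedE X w : on_sphere X w -> normalised X w = X w.
Proof. by rewrite /normalised /on_sphere /= => ->; rewrite eqxx. Qed.

Lemma uniform_on_sphere X : uniform_sphere_rv P X -> P (on_sphere X) = 1%E.
Proof.
move=> [_ + _] => <-; congr (P _); apply/seteqP; split => w /=.
  by rewrite /on_sphere /= /enorm => ->; rewrite sqrtr1.
by move=> e; rewrite /on_sphere /= -enorm_sqr e expr1n.
Qed.

Lemma spherical_normalised X : uniform_sphere_rv P X -> spherical P (normalised X).
Proof.
move=> uX; have P1 := uniform_on_sphere uX; have [mX _ invX] := uX.
have {}mX : measurable_fun setT X by exact/measurable_rvec.
have mS := measurable_on_sphere mX; have mX' := measurable_normalised mX.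
split=> [//|w|M MM A mA]; first exact: dotp_normalised.
have pre (Y : T -> rvec R N) : measurable_fun setT Y -> measurable (Y @^-1` A).
  by move=> mY; rewrite -[X in measurable X]setTI; exact: mY.
transitivity (P (X @^-1` A)).
  apply: (probability_eq_full mS P1); [exact: pre|exact: pre|].
  by move=> w Sw /=; rewrite normalisedE.
rewrite (invX M MM A mA); apply: (probability_eq_full mS P1).
- by apply: (pre (fun w => (X w : 'rV[R]_N) *m M)); exact: measurable_rvecM.
- by apply: (pre (fun w => (normalised X w : 'rV[R]_N) *m M)); exact: measurable_rvecM.
- by move=> w Sw /=; rewrite normalisedE.
Qed.

Section family.
Context {n : nat} (X : 'I_n -> T -> rvec R N).
Hypothesis uX : forall i, uniform_sphere_rv P (X i).
Hypothesis indX : mutually_independent P X.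

Let mX i : measurable_fun setT (X i).
Proof. by apply/measurable_rvec; case: (uX i). Qed.

Let all_on_sphere : set T := \bigcap_(i in [set: 'I_n]) on_sphere (X i).

Let measurable_all : measurable all_on_sphere.
Proof. by apply: fin_bigcap_measurable => // i _; exact: measurable_on_sphere. Qed.

(** By independence the probability is a product of ones. *)
Let full_all : P all_on_sphere = 1%E.
Proof.
have mB : measurable [set x : rvec R N | dotp x x = 1].
  have mid : measurable_fun setT (fun x : rvec R N => x) by exact: measurable_id.
  rewrite -[X in measurable X]setTI.
  by have := measurable_dotp mid mid measurableT (measurable_set1 (1 : R)); apply.
have := indX (fun=> mB); rewrite /all_on_sphere => ->.
by rewrite big1// => i _; exact: uniform_on_sphere (uX i).
Qed.

Lemma independent_normalised : mutually_independent P (fun i => normalised (X i)).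
Proof.
move=> A mA.
have pre i (Y : T -> rvec R N) : measurable_fun setT Y -> measurable (Y @^-1` A i).
  by move=> mY; rewrite -[X in measurable X]setTI; exact: (mY measurableT _ (mA i)).
transitivity (P (\bigcap_(i in [set: 'I_n]) (X i @^-1` A i))).
  apply: (probability_eq_full measurable_all full_all).
  - apply: fin_bigcap_measurable => // i _; apply: pre.
    exact: measurable_normalised (mX i).
  - by apply: fin_bigcap_measurable => // i _; exact: pre (mX i).
  - by move=> w Sw; split => h i _; have := h i Logic.I; rewrite /= normalisedE//; exact: Sw.
rewrite indX//; apply: eq_bigr => i _.
apply: (probability_eq_full (measurable_on_sphere (mX i)) (uniform_on_sphere (uX i))).
- exact: pre (mX i).
- by apply: pre; exact: measurable_normalised (mX i).
- by move=> w Sw /=; rewrite normalisedE.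
Qed.

Lemma gibbs_expect_normalised (beta : R) (g : rvec R N -> R) : measurable_fun setT g ->
  gibbs_expect P beta (fun i => normalised (X i)) (fun s => g (Wn beta s)) =
  gibbs_expect P beta X (fun s => g (Wn beta s)).
Proof.
move=> mg; rewrite /gibbs_expect.
have mw (Y : 'I_n -> T -> rvec R N) : (forall i, measurable_fun setT (Y i)) ->
    measurable_fun setT (fun w => gibbs_weight beta (fun i => Y i w : 'rV[R]_N)).
  move=> mY; under eq_fun do rewrite gibbs_weightE.
  apply: measurableT_comp => //; apply: measurable_funM => //.
  by apply: measurable_dotp; exact: measurable_rvec_sum.
have mgW (Y : 'I_n -> T -> rvec R N) : (forall i, measurable_fun setT (Y i)) ->
    measurable_fun setT (fun w => g (Wn beta (fun i => Y i w : 'rV[R]_N)) *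
      gibbs_weight beta (fun i => Y i w : 'rV[R]_N)).
  move=> mY; apply: measurable_funM; last exact: mw.
  by apply: measurableT_comp mg _; apply: measurable_rvecZ; exact: measurable_rvec_sum.
have mX' i := measurable_normalised (mX i).
have XE w : all_on_sphere w ->
    (fun i => normalised (X i) w) = (fun i => X i w).
  by move=> Sw; apply/funext => i; rewrite normalisedE//; exact: Sw.
congr (_ / _).
- by apply: (Rintegral_eq_full measurable_all full_all) => [||w Sw];
    [exact: mgW|exact: mgW|rewrite XE].
- by apply: (Rintegral_eq_full measurable_all full_all) => [||w Sw];
    [exact: mw|exact: mw|rewrite XE].
Qed.

End family.
End spherical_version.

Theorem theorem3p1 (R : realType) (N : nat) (beta : R) :
  (2 <= N)%N -> 0 <= beta -> beta < N%:R ->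
  exists c : R,
  forall n : nat, (0 < n)%N ->
  forall (d : measure_display) (T : measurableType d) (P : probability T R)
         (X : 'I_n -> T -> 'rV[R]_N),
    (forall i, uniform_sphere_rv P (X i)) ->
    mutually_independent P X ->
  forall (d' : measure_display) (T' : measurableType d') (Q : probability T' R)
         (Z : T' -> 'rV[R]_N),
    std_gaussian_rv Q Z ->
  forall g : 'rV[R]_N -> R,
    lipschitz_le1 g -> twice_differentiable g -> hessian_opnorm_le1 g ->
    `| gibbs_expect P beta X (fun s => g (Wn beta s)) - expect Q (fun w => g (Z w)) |
      <= c / Num.sqrt n%:R.
Proof.
move=> N2 beta0 betaN; have N0 : (0 < N)%N by exact: ltnW.
have [c Hc] := gibbs_spherical N0 beta0 betaN.
exists c => n n0 d T P X uX indX d' T' Q Z gZ g gL _ _.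
pose i0 := Ordinal N0.
have mg : measurable_fun setT (g : rvec R N -> R).
  by apply: (@lipschitz_measurable _ _ g 1) => // x y; rewrite mul1r; exact: gL.
rewrite -(gibbs_expect_normalised i0 uX indX beta mg).
apply: Hc => // [i|]; first exact: spherical_normalised (uX i).
exact: independent_normalised uX indX.
Qed.
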